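(* Let $p_1<p_2$ be finite real numbers, $\mu\in(0,1)$, and let $U(p)=(p-p_1)^{\mu-1}\tilde u(p)$ for $p\in(p_1,p_2]$, where $\tilde u\in\mathcal{C}^1([p_1,p_2],\mathbb{C})$, $\tilde u(p_1)\ne0$ and $U(p_2)=0$. Let $\varepsilon\in(0,\frac12)$. For $\omega>(p_2-p_1)^{-1/\varepsilon}$ let $p_0:=p_1+\omega^{-\varepsilon}$, let $c\in\mathbb{R}$, and let $\psi(p):=-(p-p_0)^2+c$. Put $$\tilde H(\omega,\psi,U):=\sqrt\pi\,e^{-i\frac\pi4}e^{i\omega c}\,\tilde u(p_0),\qquad\tilde K_\mu(\omega,\psi,U):=\frac{\Gamma(\mu)}{2^\mu}e^{i\frac{\pi\mu}2}e^{i\omega\psi(p_1)}\,\tilde u(p_1).$$ Let $\delta\in(\frac12,1)$ be such that $\delta>\frac12+\varepsilon$ and $\delta>\mu$, and let the constants $\tilde R_k^{(i)}(U)$ and exponents $\tilde\alpha_k^{(i)},\tilde\beta_k^{(i)}$ be those listed in the context. Then for all $\omega>(p_2-p_1)^{-1/\varepsilon}$: (1) if $\mu>\frac12$, $$\left|\int_{p_1}^{p_2}U(p)e^{i\omega\psi(p)}dp-\tilde H(\omega,\psi,U)\,\omega^{-\frac12+\varepsilon(1-\mu)}\right|\le\sum_{k=1}^9\tilde R_k^{(1)}(U)\,\omega^{-\tilde\beta_k^{(1)}+\varepsilon\tilde\alpha_k^{(1)}},$$ where $\max_{1\le k\le9}\{-\tilde\beta_k^{(1)}+\varepsilon\tilde\alpha_k^{(1)}\}<-\frac12+\varepsilon(1-\mu)$;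 (2) if $\mu=\frac12$, $$\left|\int_{p_1}^{p_2}U(p)e^{i\omega\psi(p)}dp-\big(\tilde H(\omega,\psi,U)+\tilde K_\mu(\omega,\psi,U)\big)\omega^{-\frac12+\frac12\varepsilon}\right|\le\sum_{k=1}^8\tilde R_k^{(2)}(U)\,\omega^{-\tilde\beta_k^{(2)}+\varepsilon\tilde\alpha_k^{(2)}},$$ where $\max_{1\le k\le8}\{-\tilde\beta_k^{(2)}+\varepsilon\tilde\alpha_k^{(2)}\}<-\frac12+\frac12\varepsilon$; (3) if $\mu<\frac12$, $$\left|\int_{p_1}^{p_2}U(p)e^{i\omega\psi(p)}dp-\tilde K_\mu(\omega,\psi,U)\,\omega^{-\mu+\varepsilon\mu}\right|\le\sum_{k=1}^9\tilde R_k^{(3)}(U)\,\omega^{-\tilde\beta_k^{(3)}+\varepsilon\tilde\alpha_k^{(3)}},$$ where $\max_{1\le k\le9}\{-\tilde\beta_k^{(3)}+\varepsilon\tilde\alpha_k^{(3)}\}<-\mu+\varepsilon\mu$.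
   Context: Given $\delta$ put $\gamma:=2\delta-1\in(0,1)$, let $K>0$ be the unique positive solution of $\frac{\sqrt\pi}2K^2-\frac12K-\frac{\sqrt\pi}4=0$, and $L:=\frac{\sqrt\pi}2K^\gamma$. Put $M_0:=\|\tilde u\|_{L^\infty(p_1,p_2)}$ and $M:=\|\tilde u\|_{W^{1,\infty}(p_1,p_2)}=\|\tilde u\|_{L^\infty(p_1,p_2)}+\|\tilde u'\|_{L^\infty(p_1,p_2)}$. Define the 8-tuples $(r_1,\dots,r_8):=\Big(\frac{2^{2-\mu}}\mu(2-\mu)M,\ \frac{2^{1-\mu}}\mu M,\ (1-\mu)\frac{2^{3-\mu}}3M_0,\ \frac L{1-\gamma}2^{2-\mu}(1-\mu)M,\ \frac L{1-\gamma}2^{1-\mu}M,\ \frac{\sqrt\pi}{2^{\mu-2}}M_0,\ \frac L{1-\gamma}(1-\mu)(p_2-p_1)^{1-\gamma}M,\ \frac L{1-\gamma}(p_2-p_1)^{1-\gamma}M\Big)$, $(a_1,\dots,a_8):=(2-\mu,\,1-\mu,\,4-\mu,\,1+\gamma-\mu,\,\gamma-\mu,\,3-\mu,\,2-\mu,\,1-\mu)$, $(b_1,\dots,b_8):=(1,\,1,\,2,\,\delta,\,\delta,\,\frac32,\,\delta,\,\delta)$. Then: for $i\in\{1,3\}$ and $k=1,\dots,8$, $\tilde R^{(i)}_{k+1}(U)=r_k$, $\tilde\alpha^{(i)}_{k+1}=a_k$, $\tilde\beta^{(i)}_{k+1}=b_k$; for $i=2$ and $k=1,\dots,8$, $\tilde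 R^{(2)}_k(U)=r_k$, $\tilde\alpha^{(2)}_k=a_k$, $\tilde\beta^{(2)}_k=b_k$; and $\tilde R_1^{(1)}(U)=\frac{\Gamma(\mu)}{2^\mu}M_0$, $\tilde\alpha_1^{(1)}=\tilde\beta_1^{(1)}=\mu$; $\tilde R_1^{(3)}(U)=\sqrt\pi M_0$, $\tilde\alpha_1^{(3)}=1-\mu$, $\tilde\beta_1^{(3)}=\frac12$. *)

(* Defs.v *)
From mathcomp Require Import all_boot all_order all_algebra.
From mathcomp Require Import complex.
From mathcomp Require Import all_classical all_reals all_analysis.

Set Implicit Arguments.
Unset Strict Implicit.
Unset Printing Implicit Defensive.
Import Order.TTheory GRing.Theory Num.Theory.
Import numFieldNormedType.Exports.

Local Open Scope classical_set_scope.
Local Open Scope ring_scope.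
Local Open Scope complex_scope.

Section ComplexValued.
Context {R : realType}.
Implicit Types (A : set R) (f g : R -> R) (u : R -> R[i]).

Definition modulus (z : R[i]) : R := Normc.normc z.

(* exp (i x) for x real *)
Definition expi (x : R) : R[i] := cos x +i* sin x.

Definition Cintegral A u : R[i] :=
  (\int[lebesgue_measure]_(x in A) complex.Re (u x)) +i*
  (\int[lebesgue_measure]_(x in A) complex.Im (u x)).

(* When A is a closed interval and x one of its endpoints, this is the
   one-sided derivative at x. *)
Definition is_derive_within A f (x l : R) :=
  (fun y => (f y - f x) / (y - x)) @ within A x^' --> l.

Definition C1_on A f := exists g : R -> R,
  (forall x, A x -> is_derive_within A f x (g x)) /\ {within A, continuous g}.

Definition C1_on_complex A u :=
  C1_on A (fun x => complex.Re (u x)) /\ C1_on A (fun x => complex.Im (u x)).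

Definition derive1_complex u (x : R) : R[i] :=
  derive1 (fun y => complex.Re (u y)) x +i*
  derive1 (fun y => complex.Im (u y)) x.

(* L^oo(a, b) and W^{1,oo}(a, b) norms; the latter as the sum of the sup norms
   of u and u'. *)
Definition Linfty_norm (a b : R) u : R :=
  fine (Lnorm (mrestr lebesgue_measure (measurable_itv `]a, b[)) +oo%E
          (fun x => (modulus (u x))%:E)).

Definition W1infty_norm (a b : R) u : R :=
  Linfty_norm a b u + Linfty_norm a b (derive1_complex u).

End ComplexValued.

Section GammaFunction.
Context {R : realType}.

Definition Gamma (a : R) : R :=
  \int[lebesgue_measure]_(t in `]0, +oo[) (t `^ (a - 1) * expR (- t)).

End GammaFunction.

Section PhaseAndLeadingTerms.
Context {R : realType}.
Variables (p1 eps omega c : R).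

Definition stationary_point : R := p1 + omega `^ (- eps).

Definition phase (p : R) : R := - (p - stationary_point) ^+ 2 + c.

Definition leading_H (ut : R -> R[i]) : R[i] :=
  (Num.sqrt pi)%:C * expi (- (pi / 4)) * expi (omega * c) *
  ut stationary_point.

Definition leading_K (mu : R) (ut : R -> R[i]) : R[i] :=
  (Gamma mu / 2 `^ mu)%:C * expi (pi * mu / 2) *
  expi (omega * phase p1) * ut p1.

End PhaseAndLeadingTerms.

(* The arguments i = 1, 2, 3 and k = 1, ..., 9 (k = 1, ..., 8 if i = 2) are
   numbered from 1; other values of i and k are never used. *)
Section RemainderConstants.
Context {R : realType}.
Variables (p1 p2 mu delta K : R).

Definition gamma_exponent : R := 2 * delta - 1.

Local Notation gamma := gamma_exponent.

Definition L_constant : R := Num.sqrt pi / 2 * K `^ gamma.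

Local Notation L := L_constant.

Definition common_constants (M0 M : R) : seq R :=
  [:: 2 `^ (2 - mu) / mu * (2 - mu) * M;
      2 `^ (1 - mu) / mu * M;
      (1 - mu) * (2 `^ (3 - mu) / 3) * M0;
      L / (1 - gamma) * 2 `^ (2 - mu) * (1 - mu) * M;
      L / (1 - gamma) * 2 `^ (1 - mu) * M;
      Num.sqrt pi / 2 `^ (mu - 2) * M0;
      L / (1 - gamma) * (1 - mu) * (p2 - p1) `^ (1 - gamma) * M;
      L / (1 - gamma) * (p2 - p1) `^ (1 - gamma) * M].

Definition common_alphas : seq R :=
  [:: 2 - mu; 1 - mu; 4 - mu; 1 + gamma - mu; gamma - mu; 3 - mu; 2 - mu;
      1 - mu].

Definition common_betas : seq R :=
  [:: 1; 1; 2; delta; delta; 3 / 2; delta; delta].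

Definition remainder_constant (ut : R -> R[i]) (i k : nat) : R :=
  let M0 := Linfty_norm p1 p2 ut in
  let r := common_constants M0 (W1infty_norm p1 p2 ut) in
  let s := match i with
           | 1%N => Gamma mu / 2 `^ mu * M0 :: r
           | 2%N => r
           | _ => Num.sqrt pi * M0 :: r
           end in
  s`_k.-1.

Definition remainder_alpha (i k : nat) : R :=
  let s := match i with
           | 1%N => mu :: common_alphas
           | 2%N => common_alphas
           | _ => 1 - mu :: common_alphas
           end in
  s`_k.-1.

Definition remainder_beta (i k : nat) : R :=
  let s := match i with
           | 1%N => mu :: common_betas
           | 2%N => common_betas
           | _ => 2^-1 :: common_betas
           end in
  s`_k.-1.

Variable eps : R.

Definition remainder_exponent (i k : nat) : R :=
  - remainder_beta i k + eps * remainder_alpha i k.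

Definition remainder_bound (ut : R -> R[i]) (i n : nat) (omega : R) : R :=
  \sum_(1 <= k < n.+1)
    remainder_constant ut i k * omega `^ remainder_exponent i k.

(* The maximum over 1 <= k <= n; for n >= 1 the default value, being one of
   the terms, does not affect it. *)
Definition max_remainder_exponent (i n : nat) : R :=
  \big[Num.max/remainder_exponent i 1]_(1 <= k < n.+1) remainder_exponent i k.

End RemainderConstants.

(* Main.v *)
Require Import Defs.
From mathcomp Require Import all_boot all_order all_algebra.
From mathcomp Require Import complex ring lra.
From mathcomp Require Import all_classical all_reals all_analysis.
From mathcomp Require Import measurable_realfun ess_sup_inf.

Set Implicit Arguments.
Unset Strict Implicit.
Unset Printing Implicit Defensive.
Import Order.TTheory GRing.Theory Num.Theory.
Import numFieldNormedType.Exports.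

Local Open Scope classical_set_scope.
Local Open Scope ring_scope.
Local Open Scope complex_scope.

(** Set [h = w ^ (- eps)], [p0 = p1 + h] and [q = p1 + h / 2]. For [0 < a <= 1],
    the oscillatory tail [\int_v^oo x ^ (a - 1) e ^ (i w x) dx], computed along
    the half-line [v + i r], is a primitive of [- v ^ (a - 1) e ^ (i w v)]
    continuous up to [v = 0], of size at most [v ^ (a - 1) / w], with an explicit
    leading part for large [w v]. On each of [[p1, q]], [[q, p0]] and [[p0, p2]],
    adding the amplitude times such a tail ([a = mu] next to the singularity,
    [a = 1 / 2] next to the stationary point) to the integral from [p1] to [x]
    cancels the main part of its derivative in [x]; what is left is proportional
    to the derivative of the amplitude and is bounded with the mean value
    inequality. The tails at [p0] and [p1] give [H] and [K_mu]; the leading parts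
    of the two tails at [q] cancel. *)

(** For [a < 1] the tails converge only conditionally on the real line. Their rotated form converges
    absolutely, and differentiation under the integral sign shows directly that it is the required
    primitive, without a contour argument. The cut at [q] separates two obstructions: the derivative
    of the amplitude grows like [s ^ (mu - 2)] at [p1], with [s = x - p1], which is not integrable,
    while the phase stops being a coordinate at [p0], where its derivative vanishes. Next to [p0]
    the tail [F(t)] is bounded by [w ^ (- 1 / 2)] times a multiple of [(sqrt w * t) ^ (- gamma)]:
    this is integrable at [t = 0] because [gamma < 1], and its power of [w] is
    [- (1 + gamma) / 2 = - delta]. The width [h] and the frequency [w] stay independent until the
    remainder is compared with the listed constants. Of these, numbers 7 and 8 come from [[p0, p2]],
    4 and 5 from [[q, p0]], 1 and 2 from [[p1, q]], 3 and 6 from the boundary terms at [q]. One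
    expansion contains both [H] and [K_mu] for every [mu]. The sign of [(1 - 2 eps) (2 mu - 1)]
    tells which dominates; the other one becomes the first remainder term in cases 1 and 3. *)

(** * Calculus of complex-valued functions of a real variable *)

Section ComplexCalculus.
Context {R : realType}.
Implicit Types (A : set R) (f g : R -> R) (u v : R -> R[i]) (x y a b : R).
Implicit Types (z w l m : R[i]).

Lemma cReD z w : complex.Re (z + w) = complex.Re z + complex.Re w.
Proof. by case: z; case: w. Qed.

Lemma cImD z w : complex.Im (z + w) = complex.Im z + complex.Im w.
Proof. by case: z; case: w. Qed.

Lemma cReB z w : complex.Re (z - w) = complex.Re z - complex.Re w.
Proof. by case: z; case: w. Qed.

Lemma cImB z w : complex.Im (z - w) = complex.Im z - complex.Im w.
Proof. by case: z; case: w. Qed.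

Lemma cReM z w : complex.Re (z * w) =
  complex.Re z * complex.Re w - complex.Im z * complex.Im w.
Proof. by case: z; case: w. Qed.

Lemma cImM z w : complex.Im (z * w) =
  complex.Re z * complex.Im w + complex.Im z * complex.Re w.
Proof. by case: z; case: w. Qed.

Lemma cRe_conj z : complex.Re z^*%C = complex.Re z.
Proof. by case: z. Qed.

Lemma cIm_conj z : complex.Im z^*%C = - complex.Im z.
Proof. by case: z. Qed.

Lemma complexP z w : complex.Re z = complex.Re w ->
  complex.Im z = complex.Im w -> z = w.
Proof. by case: z => a b; case: w => c d /= -> ->. Qed.

Lemma real_complexM x y : (x * y)%:C = x%:C * y%:C :> R[i].
Proof. exact: rmorphM. Qed.

Lemma real_complexN x : (- x)%:C = - x%:C :> R[i].
Proof. exact: rmorphN. Qed.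

Lemma conjcM z w : (z * w)^*%C = z^*%C * w^*%C.
Proof. exact: rmorphM. Qed.

Lemma conjcN z : (- z)^*%C = - z^*%C.
Proof. exact: rmorphN. Qed.

Lemma conjcB z w : (z - w)^*%C = z^*%C - w^*%C.
Proof. exact: rmorphB. Qed.

Lemma conjc_i : 'i%C^*%C = - 'i%C :> R[i].
Proof. by apply: complexP; rewrite /= ?oppr0. Qed.

Lemma sqr_modulus z : modulus z ^+ 2 = complex.Re z ^+ 2 + complex.Im z ^+ 2.
Proof. by case: z => a b; rewrite /modulus/= sqr_sqrtr// addr_ge0// sqr_ge0. Qed.

Lemma modulus_ge0 z : 0 <= modulus z.
Proof. by case: z => a b; exact: sqrtr_ge0. Qed.

Lemma modulusM z w : modulus (z * w) = modulus z * modulus w.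
Proof. exact: Normc.normcM. Qed.

Lemma modulusD z w : modulus (z + w) <= modulus z + modulus w.
Proof. exact: (@le_normcD R). Qed.

Lemma modulusN z : modulus (- z) = modulus z.
Proof. exact: (@normcN R). Qed.

Lemma modulusB z w : modulus (z - w) <= modulus z + modulus w.
Proof. by rewrite -(modulusN w) modulusD. Qed.

Lemma modulus_real x : modulus x%:C = `|x|.
Proof. by rewrite /modulus/= expr0n/= addr0 sqrtr_sqr. Qed.

Lemma modulus_i : modulus ('i%C : R[i]) = 1.
Proof. by rewrite /modulus/= expr0n/= add0r expr1n sqrtr1. Qed.

Lemma modulus_conj z : modulus z^*%C = modulus z.
Proof. by case: z => a b; rewrite /modulus/= sqrrN. Qed.

Lemma Re_le_modulus z : `|complex.Re z| <= modulus z.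
Proof. by case: z => a b/=; rewrite -sqrtr_sqr ler_wsqrtr// lerDl sqr_ge0. Qed.

Lemma Im_le_modulus z : `|complex.Im z| <= modulus z.
Proof. by case: z => a b/=; rewrite -sqrtr_sqr ler_wsqrtr// lerDr sqr_ge0. Qed.

Lemma modulus_le_Re_Im z : modulus z <= `|complex.Re z| + `|complex.Im z|.
Proof.
rewrite -(@ler_sqr R) ?nnegrE ?modulus_ge0 ?addr_ge0//.
rewrite sqr_modulus sqrrD !real_normK ?num_real// -addrA lerD2l lerDr.
by rewrite mulrn_wge0// mulr_ge0.
Qed.

Lemma Re_conjM_le z w :
  complex.Re z * complex.Re w + complex.Im z * complex.Im w
  <= modulus z * modulus w.
Proof.
have := Re_le_modulus (z^*%C * w); rewrite modulusM modulus_conj.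
by apply: le_trans; case: z => a b; case: w => c d /=; rewrite mulNr opprK ler_norm.
Qed.

(* A complex number is bounded by [r] as soon as all its projections
   [Re (w^* z)] are bounded by [r |w|]. *)
Lemma modulus_le_proj z (r : R) : 0 <= r ->
  complex.Re z * complex.Re z + complex.Im z * complex.Im z <= modulus z * r ->
  modulus z <= r.
Proof.
move=> r0; rewrite -!expr2 -sqr_modulus expr2.
have [->//|z0] := eqVneq (modulus z) 0.
by rewrite ler_pM2l// lt_neqAle eq_sym z0 modulus_ge0.
Qed.

Lemma expi0 : expi 0 = 1 :> R[i].
Proof. by rewrite /expi cos0 sin0. Qed.

Lemma expiD x y : expi (x + y) = expi x * expi y.
Proof. by apply/complexP; rewrite ?cReM ?cImM/= ?cosD ?sinD//; ring. Qed.

Lemma expiN x : expi (- x) = (expi x)^*%C.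
Proof. by rewrite /expi cosN sinN. Qed.

Lemma modulus_expi x : modulus (expi x) = 1.
Proof. by rewrite /modulus/= cos2Dsin2 sqrtr1. Qed.

Definition is_cderive u x l :=
  is_derive x 1 (fun t => complex.Re (u t)) (complex.Re l) /\
  is_derive x 1 (fun t => complex.Im (u t)) (complex.Im l).

Lemma is_cderive_eq u x l m : is_cderive u x l -> l = m -> is_cderive u x m.
Proof. by move=> + <-. Qed.

Lemma is_cderive_cst z x : is_cderive (fun=> z) x 0.
Proof. by split; exact: is_derive_cst. Qed.

Lemma is_cderive_real f x a : is_derive x 1 f a ->
  is_cderive (fun t => (f t)%:C) x a%:C.
Proof. by move=> fa; split => //=; exact: is_derive_cst. Qed.

Lemma is_cderiveD u v x l m : is_cderive u x l -> is_cderive v x m ->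
  is_cderive (fun t => u t + v t) x (l + m).
Proof.
move=> [u1 u2] [v1 v2]; split.
- by under eq_fun do rewrite cReD; rewrite cReD; exact: is_deriveD.
- by under eq_fun do rewrite cImD; rewrite cImD; exact: is_deriveD.
Qed.

Lemma is_cderiveM u v x l m : is_cderive u x l -> is_cderive v x m ->
  is_cderive (fun t => u t * v t) x (l * v x + u x * m).
Proof.
move=> [u1 u2] [v1 v2]; split.
- under eq_fun do rewrite cReM.
  apply: (is_derive_eq (is_deriveB (is_deriveM u1 v1) (is_deriveM u2 v2))).
  by rewrite /GRing.scale/= cReD !cReM; ring.
- under eq_fun do rewrite cImM.
  apply: (is_derive_eq (is_deriveD (is_deriveM u1 v2) (is_deriveM u2 v1))).
  by rewrite /GRing.scale/= cImD !cImM; ring.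
Qed.

Lemma is_cderiveZ z u x l : is_cderive u x l ->
  is_cderive (fun t => z * u t) x (z * l).
Proof.
move=> ul; apply: (is_cderive_eq (is_cderiveM (is_cderive_cst z x) ul)).
by rewrite mul0r add0r.
Qed.

Lemma is_cderive_conj u x l : is_cderive u x l ->
  is_cderive (fun t => (u t)^*%C) x l^*%C.
Proof.
move=> [u1 u2]; split.
- by under eq_fun do rewrite cRe_conj; rewrite cRe_conj.
- by under eq_fun do rewrite cIm_conj; rewrite cIm_conj; exact: is_deriveN.
Qed.

Lemma is_cderive_comp u f x a l : is_derive x 1 f a -> is_cderive u (f x) l ->
  is_cderive (fun t => u (f t)) x (a%:C * l).
Proof.
move=> fa [u1 u2]; split.
- apply: (is_derive_eq (is_derive1_comp u1 fa)).
  by rewrite cReM/= mul0r subr0 mulrC.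
- apply: (is_derive_eq (is_derive1_comp u2 fa)).
  by rewrite cImM/= mul0r addr0 mulrC.
Qed.

Lemma is_cderive_expi x : is_cderive expi x ('i%C * expi x).
Proof.
split.
- by apply: (is_derive_eq (is_derive_cos x)); rewrite cReM/=; ring.
- by apply: (is_derive_eq (is_derive_sin x)); rewrite cImM/=; ring.
Qed.

Lemma within_continuous_cst A a : {within A, continuous (fun=> a)}.
Proof. by move=> x; exact: cvg_cst. Qed.

Lemma within_continuousD A f g : {within A, continuous f} ->
  {within A, continuous g} -> {within A, continuous (fun t => f t + g t)}.
Proof. by move=> cf cg x; apply: cvgD; [exact: cf|exact: cg]. Qed.

Lemma within_continuousB A f g : {within A, continuous f} ->
  {within A, continuous g} -> {within A, continuous (fun t => f t - g t)}.
Proof. by move=> cf cg x; apply: cvgB; [exact: cf|exact: cg]. Qed.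

Lemma within_continuousM A f g : {within A, continuous f} ->
  {within A, continuous g} -> {within A, continuous (fun t => f t * g t)}.
Proof. by move=> cf cg x; apply: cvgM; [exact: cf|exact: cg]. Qed.

Lemma within_continuous_comp A f g : {within A, continuous f} ->
  continuous g -> {within A, continuous (fun t => g (f t))}.
Proof.
move=> cf cg x; apply: (@continuous_comp (subspace A) _ _ f g); first exact: cf.
exact: cg.
Qed.

Definition ccontinuous_on A u :=
  {within A, continuous (fun t => complex.Re (u t))} /\
  {within A, continuous (fun t => complex.Im (u t))}.

Lemma ccontinuous_on_subset A B u : A `<=` B ->
  ccontinuous_on B u -> ccontinuous_on A u.
Proof. by move=> AB [u1 u2]; split; exact: continuous_subspaceW AB _. Qed.

Lemma ccontinuous_on_cst A z : ccontinuous_on A (fun=> z).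
Proof. by split; exact: within_continuous_cst. Qed.

Lemma ccontinuous_on_real A f : {within A, continuous f} ->
  ccontinuous_on A (fun t => (f t)%:C).
Proof. by move=> cf; split => //=; exact: within_continuous_cst. Qed.

Lemma ccontinuous_onD A u v : ccontinuous_on A u -> ccontinuous_on A v ->
  ccontinuous_on A (fun t => u t + v t).
Proof.
move=> [u1 u2] [v1 v2]; split.
- by under eq_fun do rewrite cReD; exact: within_continuousD.
- by under eq_fun do rewrite cImD; exact: within_continuousD.
Qed.

Lemma ccontinuous_onM A u v : ccontinuous_on A u -> ccontinuous_on A v ->
  ccontinuous_on A (fun t => u t * v t).
Proof.
move=> [u1 u2] [v1 v2]; split.
- under eq_fun do rewrite cReM.
  by apply: within_continuousB; exact: within_continuousM.
- under eq_fun do rewrite cImM.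
  by apply: within_continuousD; exact: within_continuousM.
Qed.

Lemma ccontinuous_on_conj A u : ccontinuous_on A u ->
  ccontinuous_on A (fun t => (u t)^*%C).
Proof.
move=> [u1 u2]; split.
- by under eq_fun do rewrite cRe_conj.
- under eq_fun do rewrite cIm_conj.
  by move=> x; apply: cvgN; exact: u2.
Qed.

Lemma ccontinuous_setT u : ccontinuous_on setT u <->
  continuous (fun t => complex.Re (u t)) /\ continuous (fun t => complex.Im (u t)).
Proof.
split=> -[u1 u2]; split.
- exact: (iffRL (continuous_subspace_setT _) u1).
- exact: (iffRL (continuous_subspace_setT _) u2).
- exact: (iffLR (continuous_subspace_setT _) u1).
- exact: (iffLR (continuous_subspace_setT _) u2).
Qed.

Lemma ccontinuous_on_comp A u f : {within A, continuous f} ->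
  ccontinuous_on setT u -> ccontinuous_on A (fun t => u (f t)).
Proof.
move=> cf /ccontinuous_setT[u1 u2]; split.
- exact: (within_continuous_comp (g := fun t => complex.Re (u t))).
- exact: (within_continuous_comp (g := fun t => complex.Im (u t))).
Qed.

Lemma ccontinuous_expi : ccontinuous_on setT (@expi R).
Proof.
split; apply: continuous_subspaceT => x;
  [exact: continuous_cos|exact: continuous_sin].
Qed.

Lemma is_cderive_ccontinuous (i : interval R) u du :
  (forall x, x \in i -> is_cderive u x (du x)) -> ccontinuous_on [set` i] u.
Proof.
move=> udu; split; apply: derivable_within_continuous => x xi;
  have [u1 u2] := udu _ xi; exact: ex_derive.
Qed.

(** Projecting [u] on the direction of [u b - u a] reduces the inequality to the monotonicity of one
    real function [k]. Derivatives are required only inside the interval because the bounds [g] used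
    later, such as [s ^ mu], have infinite slope at an endpoint. *)
Lemma modulus_mean_value u du g dg a b : a <= b ->
  ccontinuous_on `[a, b] u -> {within `[a, b], continuous g} ->
  (forall x, a < x < b -> is_cderive u x (du x)) ->
  (forall x, a < x < b -> is_derive x 1 g (dg x)) ->
  (forall x, a < x < b -> modulus (du x) <= dg x) ->
  modulus (u b - u a) <= g b - g a.
Proof.
move=> ab [cu1 cu2] cg udu gdg ule.
have aab : a \in `[a, b] by rewrite in_itv/= lexx ab.
have bab : b \in `[a, b] by rewrite in_itv/= lexx ab.
have gab : g a <= g b.
  apply: (@ger0_derive1_le_cc R g a b) => // x; rewrite in_itv/= => xab.
    by have := gdg _ xab => ?; exact: ex_derive.
  have := gdg _ xab => ?; rewrite derive1E derive_val.
  by rewrite (le_trans (modulus_ge0 _) (ule _ xab)).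
set w := u b - u a.
apply: modulus_le_proj; first by rewrite subr_ge0.
pose f x := complex.Re w * complex.Re (u x) + complex.Im w * complex.Im (u x).
pose k x := modulus w * g x - f x.
have dk x : a < x < b -> is_derive x 1 k (modulus w * dg x -
    (complex.Re w * complex.Re (du x) + complex.Im w * complex.Im (du x))).
  move=> xab; have [u1 u2] := udu _ xab; have g1 := gdg _ xab.
  exact: (is_deriveB (is_deriveZ _ g1) (is_deriveD (is_deriveZ _ u1)
    (is_deriveZ _ u2))).
have : k a <= k b.
  apply: (@ger0_derive1_le_cc R k a b) => // [x|x|].
  - by rewrite in_itv/= => /dk ?; exact: ex_derive.
  - rewrite in_itv/= => xab; have := dk _ xab => ?; rewrite derive1E derive_val.
    rewrite subr_ge0 (le_trans (Re_conjM_le _ _))// ler_wpM2l ?modulus_ge0//.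
    exact: ule.
  - apply: within_continuousB.
      by apply: within_continuousM => //; exact: within_continuous_cst.
    apply: within_continuousD; apply: within_continuousM => //;
      exact: within_continuous_cst.
rewrite /k /f -subr_ge0 => H; rewrite -subr_ge0; apply: le_trans H _.
rewrite le_eqVlt; apply/orP; left; apply/eqP.
by rewrite {3 6}/w cReB cImB; ring.
Qed.

End ComplexCalculus.

(** * Real powers, and integrals with a singularity at the left endpoint *)

Section RealIntegrals.
Context {R : realType}.
Implicit Types (f F g : R -> R) (a b c x : R).
Local Notation leb := (@lebesgue_measure R).

Lemma continuous_powR c x : 0 < x -> {for x, continuous (fun t => t `^ c)}.
Proof.
move=> x0; apply: differentiable_continuous; apply/derivable1_diffP.
by apply: derivable_powR; rewrite in_itv/= andbT.
Qed.

(** Truncating at 0 gives a function continuous on the whole line, so that [f t ^ c] with [f >= 0]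
    is continuous by composition even where [f] vanishes. *)
Lemma continuous_max0_powR c : 0 < c ->
  continuous (fun t : R => (Num.max 0 t) `^ c).
Proof.
move=> c0 x; have [x0|x0] := leP x 0.
- rewrite /continuous_at (max_idPl x0) powR0 ?gt_eqF//.
  apply/cvgrPdist_lt => e e0; near=> t.
  rewrite sub0r normrN ger0_norm ?powR_ge0//.
  rewrite -[ltRHS]powRr1 1?ltW// -(mulVf (lt0r_neq0 c0)) powRrM.
  rewrite gt0_ltr_powR ?nnegrE ?powR_ge0 ?le_max ?lexx// gt_max powR_gt0//=.
  by near: t; apply: lt_nbhsl; rewrite (le_lt_trans x0)// powR_gt0.
- rewrite /continuous_at (max_idPr (ltW x0)).
  apply: (@cvg_trans _ (t `^ c @[t --> x])).
    apply: near_eq_cvg; near=> t.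
    have t0 : 0 <= t by apply: ltW; near: t; exact: lt_nbhsr.
    by rewrite (max_idPr t0).
  exact: continuous_powR.
Unshelve. all: end_near. Qed.

Lemma within_continuous_eq (A : set R) f g : {in A, f =1 g} ->
  {within A, continuous f} -> {within A, continuous g}.
Proof. by move=> fg; apply: subspace_eq_continuous => x xA; exact: fg. Qed.

Lemma within_continuous_powR (A : set R) f c : 0 < c ->
  {within A, continuous f} -> (forall x, A x -> 0 <= f x) ->
  {within A, continuous (fun t => f t `^ c)}.
Proof.
move=> c0 cf f0; apply: within_continuous_eq (within_continuous_comp cf
  (continuous_max0_powR c0)).
by move=> x /[1!inE] /f0 fx0; rewrite (max_idPr fx0).
Qed.

Lemma is_derive_subr a x : is_derive x 1 (fun t => t - a) 1.
Proof. by apply: is_derive_eq; rewrite subr0. Qed.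

Lemma is_derive_subl a x : is_derive x 1 (fun t => a - t) (-1).
Proof.
apply: (is_derive_eq (is_deriveB (is_derive_cst a x 1) (is_derive_id x 1))).
exact: sub0r.
Qed.

Lemma is_derive_powR_comp f c x df : 0 < f x -> is_derive x 1 f df ->
  is_derive x 1 (fun t => f t `^ c) (c * f x `^ (c - 1) * df).
Proof.
by move=> fx0 fdf; exact: (is_derive1_comp (is_derive1_powR c fx0) fdf).
Qed.

Lemma le0_ler_powR c : c <= 0 ->
  {in Num.pos &, {homo (@powR R) ^~ c : x y / x <= y >-> y <= x}}.
Proof.
move=> c0 x y /[!posrE] x0 y0 xy; rewrite -[c]opprK 2!(powRN _ (- c)).
by rewrite lef_pV2 ?posrE ?powR_gt0// ge0_ler_powR ?oppr_ge0// nnegrE ltW.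
Qed.

Lemma bigcup_itv_left (u : R^nat) a (t : itv_bound R) :
  (forall n, a < u n) -> u @ \oo --> a ->
  \bigcup_n [set` Interval (BLeft (u n)) t] = [set` Interval (BRight a) t].
Proof.
move=> au ua; apply/seteqP; split => [x [n _]|x] /=.
  rewrite !itv_boundlr => /andP[/= nx ->]; rewrite andbT/= bnd_simp.
  by move: nx; rewrite bnd_simp; exact: lt_le_trans.
rewrite !itv_boundlr => /andP[/= ax xt]; move: ax; rewrite bnd_simp => ax.
have [n _ /(_ n (leqnn _)) nx] := ua _ (lt_nbhsl ax).
exists n => //=.
by rewrite itv_boundlr/= xt andbT bnd_simp ltW.
Qed.

(** Monotone convergence along an exhaustion from the left. The right bound [t] is arbitrary, to
    serve both bounded intervals and half-lines. *)
Lemma cvg_integral_left (u : R^nat) a (t : itv_bound R) f :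
  (forall n, a < u n) -> nonincreasing_seq u -> u @ \oo --> a ->
  measurable_fun [set` Interval (BRight a) t] f ->
  (forall x, [set` Interval (BRight a) t] x -> 0 <= f x) ->
  (\int[leb]_(x in [set` Interval (BLeft (u n)) t]) (f x)%:E)%E
    @[n --> \oo] -->
  (\int[leb]_(x in [set` Interval (BRight a) t]) (f x)%:E)%E.
Proof.
move=> au nu ua mf f0; rewrite -(bigcup_itv_left t au ua).
have sub n : [set` Interval (BLeft (u n)) t] `<=` [set` Interval (BRight a) t].
  by rewrite -(bigcup_itv_left t au ua) => x nx; exists n.
apply: ge0_nondecreasing_set_cvg_integral => //.
- by move=> m n mn; apply/subsetPset; apply: subset_itvr; rewrite bnd_simp nu.
- by move=> n; apply/measurable_EFinP; move: mf; apply: measurable_funS.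
- by move=> n x /sub xt; rewrite lee_fin f0.
Qed.

(** The denominator starts at 2, so that all the points, including the one for [n = 0], lie strictly
    between [a] and [b]. *)
Definition left_approx a b n : R := a + (b - a) / n.+2%:R.

Lemma left_approx_itv a b n : a < b -> a < left_approx a b n < b.
Proof.
move=> ab; rewrite ltrDl divr_gt0 ?subr_gt0//= -ltrBrDl.
by rewrite ltr_pdivrMr// ltr_pMr ?subr_gt0// ltr1n.
Qed.

Lemma left_approx_nincr a b : a < b -> nonincreasing_seq (left_approx a b).
Proof.
move=> ab m n mn; rewrite lerD2l ler_pM2l ?subr_gt0//.
by rewrite lef_pV2 ?posrE// ler_nat !ltnS.
Qed.

Lemma cvg_left_approx a b : left_approx a b @ \oo --> a.
Proof.
rewrite -[X in _ --> X]addr0; apply: cvgD; first exact: cvg_cst.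
rewrite -(mulr0 (b - a)); apply: cvgMr.
have := @cvg_harmonic R; rewrite -(cvg_shiftS (@harmonic R)).
exact.
Qed.

(** The integrand may blow up at [a], as [(x - a) ^ c] with [c < 0] does. The usual theorem applies
    on [[a_n, b]] with [a_n] decreasing to [a]; positivity gives the limit of the integrals and
    continuity of [F] at [a] that of the increments. *)
Lemma ge0_FTC2_oc f F a b : a < b ->
  (forall x, a < x <= b -> 0 <= f x) ->
  (forall x, a < x <= b -> {for x, continuous f}) ->
  {within `[a, b], continuous F} ->
  (forall x, a < x < b -> is_derive x 1 F (f x)) ->
  (\int[leb]_(x in `]a, b]) (f x)%:E = (F b - F a)%:E)%E.
Proof.
move=> ab f0 cf cF dF.
have wcf c : a < c -> {within `[c, b], continuous f}.
  move=> ac; apply: continuous_in_subspaceT => x; rewrite inE/= in_itv/=.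
  by move=> /andP[cx xb]; apply: cf; rewrite xb (lt_le_trans ac).
have au n : a < left_approx a b n by have /andP[] := left_approx_itv n ab.
have ua := @cvg_left_approx a b.
have mf : measurable_fun `]a, b] f.
  rewrite -(bigcup_itv_left (BRight b) au ua); apply/measurable_fun_bigcup => // n.
  by apply: subspace_continuous_measurable_fun => //; exact: wcf.
have H := cvg_integral_left au (left_approx_nincr ab) ua mf f0; apply/esym.
apply: (@cvg_unique _ _ _ _ _ _ _ H) => //.
have E n : (\int[leb]_(x in `[left_approx a b n, b]) (f x)%:E =
    (F b - F (left_approx a b n))%:E)%E.
  have /andP[an nb] := left_approx_itv n ab.
  rewrite (@continuous_FTC2 _ f F)//.
  - exact: wcf.
  - have /(continuous_within_itvP _ nb)[_ H1 H2] :
        {within `[left_approx a b n, b], continuous F}.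
      by apply: continuous_subspaceW cF; apply: subset_itvr; rewrite bnd_simp ltW.
    split => // x; rewrite in_itv/= => /andP[nx xb].
    by have := dF x; rewrite xb (lt_trans an nx) => /(_ isT) ?; exact: ex_derive.
  - move=> x; rewrite in_itv/= => /andP[nx xb].
    have := dF x; rewrite xb (lt_trans an nx) => /(_ isT) ?.
    by rewrite derive1E derive_val.
rewrite (_ : (fun _ => _) = (fun n => (F b - F (left_approx a b n))%:E));
  last first.
  by apply/funext => n; exact: E.
apply: cvg_EFin; first exact: nearW.
apply: cvgB; first exact: cvg_cst.
have /(continuous_within_itvP _ ab)[_ Fa _] := cF.
by move/cvg_at_rightP : Fa; apply.
Qed.

End RealIntegrals.

(** * Integrals over the half-line: exponential decay and the Gamma function *)

Section GammaIntegrals.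
Context {R : realType}.
Implicit Types (f F g : R -> R) (a b c x : R).
Local Notation leb := (@lebesgue_measure R).

Lemma integrable_powR_oc a b c : a < b -> -1 < c ->
  leb.-integrable `]a, b] (EFin \o (fun x => (x - a) `^ c)).
Proof.
move=> ab c1; have c10 : 0 < c + 1 by rewrite -ltrBlDr sub0r.
have m : measurable_fun (`]a, b] : set (measurableTypeR R)) (fun x => (x - a) `^ c).
  apply: (@measurableT_comp _ _ _ _ _ _ (@powR R ^~ c)).
    exact: measurable_powR.
  exact: measurable_funB.
apply/integrableP; split; first exact/measurable_EFinP.
pose F x := (x - a) `^ (c + 1) / (c + 1).
rewrite (_ : (\int[leb]_(x in _) _)%E = (F b - F a)%:E); first exact: ltry.
transitivity (\int[leb]_(x in `]a, b]) ((x - a) `^ c)%:E)%E.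
  by apply: eq_integral => x _ /=; rewrite ger0_norm// powR_ge0.
apply: ge0_FTC2_oc => //.
- by move=> x _; exact: powR_ge0.
- move=> x /andP[ax _].
  apply: (@continuous_comp _ _ _ (fun x => x - a) (fun t => t `^ c)).
    by apply: continuousB; [exact: cvg_id|exact: cvg_cst].
  by apply: continuous_powR; rewrite subr_gt0.
- apply: within_continuousM; last exact: within_continuous_cst.
  apply: within_continuous_powR => //.
    by apply: continuous_subspaceT => x; apply: cvgB;
      [exact: cvg_id|exact: cvg_cst].
  by move=> x/=; rewrite in_itv/= subr_ge0 => /andP[].
- move=> x /andP[ax xb].
  have xa0 : 0 < x - a by rewrite subr_gt0.
  have H := is_derive_powR_comp (f := fun t => t - a) (c + 1) xa0
    (is_derive_subr a x).
  have := is_deriveM H (is_derive_cst (c + 1)^-1 x 1).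
  move/is_derive_eq; apply; rewrite scaler0 add0r /GRing.scale/=.
  by rewrite addrK mulr1 mulKf ?gt_eqF.
Qed.

Lemma integral_expRN :
  (\int[leb]_(x in `[0%R, +oo[) (expR (- x))%:E = 1%:E :> \bar R)%E.
Proof.
pose F (x : R) := - expR (- x).
have -> : (1 = 0%:E - (F 0)%:E :> \bar R)%E by rewrite /F oppr0 expR0 -EFinB
  sub0r opprK.
apply: ge0_continuous_FTC2y.
- by move=> x _; exact: expR_ge0.
- apply: continuous_subspaceT => x.
  by apply: continuous_comp; [exact: continuousN|exact: continuous_expR].
- by rewrite -oppr0; apply: cvgN; exact: cvgr_expR.
- by move=> x _; exact: ex_derive.
- by apply: cvg_at_right_filter; apply: cvgN; apply: continuous_comp;
    [exact: continuousN|exact: continuous_expR].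
- move=> x _.
  by rewrite derive1E derive_val /GRing.scale/= mulrN1 opprK.
Qed.

Lemma integrable_expRN : leb.-integrable `[0, +oo[ (EFin \o (fun x => expR (- x))).
Proof.
apply/integrableP; split.
  by apply/measurable_EFinP; apply: measurableT_comp => //; exact: measurableT_comp.
rewrite (_ : (\int[leb]_(x in _) _)%E =
    (\int[leb]_(x in `[0%R, +oo[) (expR (- x))%:E)%E); last first.
  by apply: eq_integral => x _ /=; rewrite ger0_norm// expR_ge0.
by rewrite integral_expRN ltry.
Qed.

Lemma measurable_Gamma (A : set (measurableTypeR R)) a :
  measurable_fun A (fun t => t `^ (a - 1) * expR (- t)).
Proof.
apply: measurable_funM.
  by apply: (@measurableT_comp _ _ _ _ _ _ (@powR R ^~ (a - 1))) => //;
    exact: measurable_powR.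
by apply: measurableT_comp => //; exact: measurableT_comp.
Qed.

Lemma integrable_setU (A B : set (measurableTypeR R)) f :
  measurable A -> measurable B ->
  leb.-integrable A (EFin \o f) -> leb.-integrable B (EFin \o f) ->
  leb.-integrable (A `|` B) (EFin \o f).
Proof.
move=> mA mB fA fB; have mAB := measurableU _ _ mA mB.
have mf : measurable_fun (A `|` B) (EFin \o f).
  by apply/(measurable_funU _ mA mB); split; [move: fA|move: fB] => /integrableP[].
apply: (@le_integrable _ _ _ _ _ mAB _
  ((abse \o ((EFin \o f) \_ A)) \+ (abse \o ((EFin \o f) \_ B)))) => //.
- move=> x ABx; rewrite [leRHS]gee0_abs ?adde_ge0//= !patchE.
  case: ABx => [xA|xB].
    by rewrite mem_set//= leeDl//; exact: abse_ge0.
  by rewrite [x \in B]mem_set//= leeDr//; exact: abse_ge0.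
- apply: (@integrableS _ _ _ _ setT) => //.
  apply: integrableD => //; apply: integrable_abse.
    exact/(integrable_mkcond _ mA).
  exact/(integrable_mkcond _ mB).
Qed.

(** The power alone dominates on []0, 1]]. On []1, +oo[] the exponential does, since [a <= 1] makes
    the power at most 1. *)
Lemma integrable_Gamma a : 0 < a -> a <= 1 ->
  leb.-integrable `]0, +oo[ (EFin \o (fun t => t `^ (a - 1) * expR (- t))).
Proof.
move=> a0 a1.
have U : `]0%R, +oo[%classic = `]0, 1] `|` `]1, +oo[ :> set R.
  by rewrite -itv_bndbnd_setU// bnd_simp.
rewrite U; apply: integrable_setU => //.
- have H : leb.-integrable `]0, 1] (EFin \o (fun x => (x - 0) `^ (a - 1))).
    by apply: integrable_powR_oc => //; rewrite ltrBrDr addNr.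
  apply: le_integrable H => //.
    by apply/measurable_EFinP; exact: measurable_Gamma.
  move=> x; rewrite /= in_itv/= => /andP[x0 x1]; rewrite subr0 lee_fin.
  rewrite normrM ler_piMr// ger0_norm ?expR_ge0// expR_le1 oppr_le0.
  exact: ltW.
- have H : leb.-integrable `]1, +oo[ (EFin \o (fun x => expR (- x))).
    apply: integrableS integrable_expRN => //.
    by apply: subset_itvr; rewrite bnd_simp.
  apply: le_integrable H => //.
    by apply/measurable_EFinP; exact: measurable_Gamma.
  move=> x; rewrite /= in_itv/= andbT => x1; rewrite lee_fin.
  rewrite normrM ler_piMl// ger0_norm ?powR_ge0//.
  rewrite -[leRHS](powRr0 x) ler_powR ?subr_le0//; exact: ltW.
Qed.

Lemma Rintegral_expRN : \int[leb]_(x in `]0%R, +oo[) expR (- x) = 1.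
Proof.
rewrite Rintegral_itv_obnd_cbnd.
  by rewrite /Rintegral integral_expRN.
by apply: integrableS integrable_expRN => //; apply: subset_itvr; rewrite bnd_simp.
Qed.

Lemma integrableZ_expRN c :
  leb.-integrable `]0, +oo[ (EFin \o (fun x => c * expR (- x))).
Proof.
have H : leb.-integrable `]0, +oo[ (EFin \o (fun x => expR (- x))).
  by apply: integrableS integrable_expRN => //; apply: subset_itvr;
    rewrite bnd_simp.
have : leb.-integrable `]0, +oo[ (fun x => c%:E * (expR (- x))%:E)%E.
  exact: integrableZl.
exact.
Qed.

Lemma integrable_le_expRN f c : measurable_fun (`]0, +oo[ : set
  (measurableTypeR R)) f ->
  (forall x, 0 < x -> `|f x| <= c * expR (- x)) ->
  leb.-integrable `]0, +oo[ (EFin \o f).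
Proof.
move=> mf fc.
apply: le_integrable (integrableZ_expRN c) => //; first exact/measurable_EFinP.
move=> x; rewrite /= in_itv/= andbT => x0; rewrite lee_fin.
by rewrite (le_trans (fc _ x0))// ler_norm.
Qed.

Lemma Rintegral_decay_FTC2y f F c : continuous f ->
  (forall x, 0 <= x -> `|f x| <= c * expR (- x)) ->
  (forall x, is_derive x 1 F (f x)) -> F x @[x --> +oo] --> 0 ->
  \int[leb]_(x in `]0, +oo[) f x = - F 0.
Proof.
move=> cf fc dF F0.
have fi : leb.-integrable `]0, +oo[ (EFin \o f).
  by apply: (@integrable_le_expRN _ c); [apply: measurable_funTS|move=> x /ltW;
    exact: fc];
    exact: continuous_measurable_fun.
have ei := integrableZ_expRN c.
have ei1 : leb.-integrable `]0, +oo[ (EFin \o (fun x => expR (- x))).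
  by apply: integrableS integrable_expRN => //; apply: subset_itvr;
    rewrite bnd_simp.
(* [f] has no sign, whereas the fundamental theorem on a half-line is applied to nonnegative
   functions. By the decay hypothesis, adding [c * exp (- x)] makes [f] nonnegative; its known
   integral [c] is removed at the end. *)
pose g x := f x + c * expR (- x).
pose G x := F x - c * expR (- x).
have : \int[leb]_(x in `]0, +oo[) g x = 0 - G 0.
  rewrite Rintegral_itv_obnd_cbnd; last first.
    have : leb.-integrable `]0, +oo[ ((EFin \o f) \+ (EFin \o
      (fun x => c * expR (- x))%R))%E.
      exact: integrableD.
    exact.
  have cg : continuous g.
    move=> x; apply: cvgD; first exact: cf.
    apply: cvgM; first exact: cvg_cst.
    by apply: continuous_comp; [exact: continuousN|exact: continuous_expR].
  have dG x : is_derive x 1 G (g x).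
    have := is_deriveB (dF x) (is_deriveZ c (is_derive1_comp (is_derive_expR (- x))
      (is_deriveNid x 1))).
    by move/is_derive_eq; apply; rewrite /g /GRing.scale/= mulrN1 mulrN opprK.
  have dG' x : derivable G x 1 by have := dG x => ?; exact: ex_derive.
  apply: Rintegral_ge0_continuous_FTC2y => //.
  - move=> x x0; rewrite /g -lerBlDr sub0r lerNl (le_trans _ (fc _ x0))//.
    by rewrite -normrN ler_norm.
  - exact: continuous_subspaceT.
  - rewrite -(subr0 0); apply: cvgB => //.
    by rewrite -(mulr0 c); apply: cvgM; [exact: cvg_cst|exact: cvgr_expR].
  - by apply: cvg_at_right_filter; apply: differentiable_continuous;
      exact/derivable1_diffP.
  - by move=> x _; have := dG x => ?; rewrite derive1E derive_val.
rewrite /g RintegralD// RintegralZl// Rintegral_expRN mulr1 /G oppr0 expR0 mulr1.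
by move=> H; apply: (addIr c); rewrite H; ring.
Qed.

Lemma cvgy_powR c : 0 < c -> (x `^ c) @[x --> +oo] --> +oo.
Proof.
move=> c0; apply/cvgryPgt => M; near=> x.
have x0 : 0 < x by near: x; apply: nbhs_pinfty_gt; rewrite num_real.
have [M0|M0] := leP M 0; first by rewrite (le_lt_trans M0) ?powR_gt0.
rewrite -[ltLHS]powRr1 1?ltW// -(mulVf (lt0r_neq0 c0)) powRrM.
have Mx : M `^ c^-1 < x by near: x; apply: nbhs_pinfty_gt; rewrite num_real.
by rewrite gt0_ltr_powR ?nnegrE ?powR_ge0 ?(ltW x0).
Unshelve. all: end_near. Qed.

Lemma cvgy_powR_lt0 c : c < 0 -> (x `^ c) @[x --> +oo] --> 0.
Proof.
move=> c0; apply/cvgrPdist_le => e e0; near=> x.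
rewrite sub0r normrN ger0_norm ?powR_ge0//.
have Mx : e `^ c^-1 <= x by near: x; apply: nbhs_pinfty_ge; rewrite num_real.
have e1 : 0 < e `^ c^-1 by rewrite powR_gt0.
have -> : e = (e `^ c^-1) `^ c.
  by rewrite -powRrM mulVf ?lt_eqF// powRr1// ltW.
by rewrite le0_ler_powR ?posrE// ?(lt_le_trans e1 Mx)// ltW.
Unshelve. all: end_near. Qed.

(* The integrand of [Gamma (1 / 2)] is not continuous at [0], so that the
   substitution is done away from [0] before passing to the limit. *)
Lemma Gamma_half : Gamma (1 / 2) = Num.sqrt pi :> R.
Proof.
pose g x : R := x `^ (1 / 2 - 1) * expR (- x).
have cG : continuous (fun x : R => 2 * gauss_fun x).
  by move=> x; apply: cvgM; [exact: cvg_cst|exact: continuous_gauss_fun].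
have E (b : R) : 0 < b -> (\int[leb]_(x in `[(b `^ (1 / 2))%R, +oo[)
  (2 * gauss_fun x)%:E =
    \int[leb]_(x in `[b, +oo[) (g x)%:E)%E.
  move=> b0; pose F (x : R) := x `^ (1 / 2);
    pose f (x : R) := 1 / 2 * x `^ (1 / 2 - 1).
  have dF (x : R) : 0 < x -> is_derive x 1 F (f x) by exact: is_derive1_powR.
  have dF1 (x : R) : 0 < x -> derive1 F x = f x.
    by move=> /dF ?; rewrite derive1E derive_val.
  have cf (x : R) : 0 < x -> {for x, continuous f}.
    by move=> x0; apply: cvgM; [exact: cvg_cst|exact: continuous_powR].
  have nf (x : R) : 0 < x -> \forall y \near x, f y = derive1 F y.
    by move=> x0; near=> y; rewrite dF1//; near: y; exact: lt_nbhsr.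
  rewrite (@increasing_ge0_integration_by_substitutiony _ F
    (fun x => 2 * gauss_fun x) b).
  - apply: eq_integral => x /[1!inE]/=; rewrite in_itv/= andbT => bx.
    have x0 := lt_le_trans b0 bx.
    congr EFin; rewrite !fctE dF1// /gauss_fun /f /g /F -powR_mulrn ?powR_ge0//
      -powRrM.
    by rewrite mul1r mulVf// powRr1 ?(ltW x0)//; field.
  - move=> x y; rewrite !in_itv/= !andbT => bx yx xy.
    by rewrite /F gt0_ltr_powR// nnegrE ltW// (lt_le_trans b0).
  - move=> x; rewrite in_itv/= andbT => /(lt_trans b0) x0.
    rewrite /continuous_at dF1//.
    by apply: cvg_trans (cf _ x0); apply: near_eq_cvg; exact: nf.
  - apply/cvg_ex; exists (f b); apply: cvg_at_right_filter.
    by apply: cvg_trans (cf _ b0); apply: near_eq_cvg; exact: nf.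
  - apply/cvg_ex; exists (1 / 2 * 0); apply: (@cvg_trans _ (f x @[x --> +oo])).
      apply: near_eq_cvg; near=> x.
      have x0 : 0 < x by near: x; apply: nbhs_pinfty_gt; rewrite num_real.
      by rewrite dF1.
    apply: cvgM; first exact: cvg_cst.
    by apply: cvgy_powR_lt0; lra.
  - split=> [x|].
      by rewrite in_itv/= andbT => /(lt_trans b0) /dF ?; exact: ex_derive.
    by apply: cvg_at_right_filter; exact: continuous_powR.
  - by apply: cvgy_powR; lra.
  - exact: continuous_subspaceT.
  - by move=> x _; rewrite mulr_ge0// gauss_fun_ge0.
pose u := left_approx (0 : R) 1.
have u0 n : 0 < u n by have /andP[] := left_approx_itv n (ltr01 : 0 < 1 :> R).
have nu : nonincreasing_seq u by exact: left_approx_nincr.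
have cu : u @ \oo --> (0 : R) by exact: cvg_left_approx.
pose v n := u n `^ (1 / 2).
have h2 : 0 < 1 / 2 :> R by lra.
have v0 n : 0 < v n by exact: powR_gt0.
have nv : nonincreasing_seq v.
  by move=> m n mn; rewrite ge0_ler_powR ?nnegrE ?(ltW (u0 _)) ?(ltW h2)// nu.
have cv : v @ \oo --> (0 : R).
  have := @continuous_max0_powR R _ h2 0;
    rewrite /continuous_at maxxx powR0 ?gt_eqF//.
  move=> H; apply: cvg_trans (cvg_comp u _ cu H); apply: near_eq_cvg.
  by apply: nearW => n /=; rewrite /v (max_idPr _)// ltW.
have H1 := cvg_integral_left u0 nu cu (@measurable_Gamma `]0, +oo[ (1 / 2)).
have H2 := @cvg_integral_left _ v 0 (BInfty _ false)
  (fun x => 2 * gauss_fun x) v0 nv cv.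
have G : (\int[leb]_(x in `]0%R, +oo[) (2 * gauss_fun x)%:E =
          \int[leb]_(x in `]0%R, +oo[) (g x)%:E)%E.
  apply: cvg_unique (H2 _ _) _ => //.
  - by apply: measurable_funTS; exact: continuous_measurable_fun.
  - by move=> x _; rewrite mulr_ge0// gauss_fun_ge0.
  rewrite (_ : (fun _ => _) = (fun n => \int[leb]_(x in `[u n, +oo[) (g x)%:E)%E);
    last by apply/funext => n; exact: E.
  by apply: H1 => x _; rewrite mulr_ge0 ?powR_ge0 ?expR_ge0.
rewrite /Gamma /Rintegral -/g -G.
have mg : measurable_fun (`]0, +oo[ : set (measurableTypeR R)) (EFin \o
  (fun x => 2 * gauss_fun x)).
  by apply/measurable_EFinP; apply: measurable_funTS;
    exact: continuous_measurable_fun.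
rewrite integral_itv_obnd_cbnd//.
under eq_integral do rewrite EFinM.
rewrite ge0_integralZl//.
- by rewrite integral0y_gauss -EFinM/= mulrCA divff// mulr1.
- by apply/measurable_EFinP; apply: measurable_funTS; exact: measurable_gauss_fun.
- by move=> x _; rewrite lee_fin gauss_fun_ge0.
Unshelve. all: end_near. Qed.

End GammaIntegrals.

(** * Complex integrals: triangle inequality, decay and dependence on a parameter *)

Section ComplexIntegrals.
Context {R : realType}.
Local Notation leb := (@lebesgue_measure R).
Implicit Types (A : set (measurableTypeR R)) (u v : R -> R[i]) (g : R -> R).
Implicit Types (z w : R[i]).

Definition cmeasurable A u :=
  measurable_fun A (fun x => complex.Re (u x)) /\
  measurable_fun A (fun x => complex.Im (u x)).

Definition cintegrable A u :=
  leb.-integrable A (EFin \o (fun x => complex.Re (u x))) /\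
  leb.-integrable A (EFin \o (fun x => complex.Im (u x))).

Lemma cmeasurableM A u v : cmeasurable A u -> cmeasurable A v ->
  cmeasurable A (fun x => u x * v x).
Proof.
move=> [u1 u2] [v1 v2]; split.
- by under eq_fun do rewrite cReM; apply: measurable_funB; exact: measurable_funM.
- by under eq_fun do rewrite cImM; apply: measurable_funD; exact: measurable_funM.
Qed.

Lemma cmeasurable_real A g : measurable_fun A g ->
  cmeasurable A (fun x => (g x)%:C).
Proof. by move=> mg; split => //=; exact: measurable_cst. Qed.

Lemma cmeasurable_expi A g : measurable_fun A g ->
  cmeasurable A (fun x => expi (g x)).
Proof.
move=> mg; split => /=.
- apply: measurableT_comp mg; apply: continuous_measurable_fun.
  exact: continuous_cos.
- apply: measurableT_comp mg; apply: continuous_measurable_fun.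
  exact: continuous_sin.
Qed.

Lemma ccontinuous_cmeasurable A u : measurable A ->
  ccontinuous_on A u -> cmeasurable A u.
Proof. by move=> mA [u1 u2]; split; exact: subspace_continuous_measurable_fun. Qed.

Lemma cintegrable_le A u g : measurable A -> cmeasurable A u ->
  leb.-integrable A (EFin \o g) -> (forall x, A x -> modulus (u x) <= g x) ->
  cintegrable A u.
Proof.
move=> mA [u1 u2] gi ug; split; apply: le_integrable gi => //.
- exact/measurable_EFinP.
- move=> x Ax; rewrite lee_fin (le_trans (Re_le_modulus _))//.
  by rewrite (le_trans (ug _ Ax))// ler_norm.
- exact/measurable_EFinP.
- move=> x Ax; rewrite lee_fin (le_trans (Im_le_modulus _))//.
  by rewrite (le_trans (ug _ Ax))// ler_norm.
Qed.

Lemma integrable_lincomb A (c d : R) (f g : R -> R) : measurable A ->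
  leb.-integrable A (EFin \o f) -> leb.-integrable A (EFin \o g) ->
  leb.-integrable A (EFin \o (fun x => c * f x + d * g x)).
Proof.
move=> mA fi gi.
have : leb.-integrable A ((fun x => c%:E * (f x)%:E) \+ (fun x => d%:E *
  (g x)%:E))%E.
  by apply: integrableD => //; exact: integrableZl.
exact.
Qed.

Lemma Rintegral_lincomb A (c d : R) (f g : R -> R) : measurable A ->
  leb.-integrable A (EFin \o f) -> leb.-integrable A (EFin \o g) ->
  \int[leb]_(x in A) (c * f x + d * g x) =
  c * \int[leb]_(x in A) f x + d * \int[leb]_(x in A) g x.
Proof.
move=> mA fi gi; rewrite RintegralD// ?RintegralZl//.
- by have : leb.-integrable A (fun x => c%:E * (f x)%:E)%E by exact: integrableZl.
- by have : leb.-integrable A (fun x => d%:E * (g x)%:E)%E by exact: integrableZl.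
Qed.

Lemma eq_Cintegral A u v : (forall x, A x -> u x = v x) ->
  Cintegral A u = Cintegral A v.
Proof.
by move=> uv; congr Complex; apply: eq_Rintegral => x /set_mem /uv ->.
Qed.

Lemma cintegrableZ A z u : measurable A -> cintegrable A u ->
  cintegrable A (fun x => z * u x).
Proof.
move=> mA [u1 u2]; split.
- under eq_fun do rewrite cReM -mulNr.
  exact: integrable_lincomb.
- under eq_fun do rewrite cImM.
  exact: integrable_lincomb.
Qed.

Lemma CintegralZ A z u : measurable A -> cintegrable A u ->
  Cintegral A (fun x => z * u x) = z * Cintegral A u.
Proof.
move=> mA [u1 u2]; apply: complexP.
- rewrite cReM/=; under eq_Rintegral do rewrite cReM -mulNr.
  by rewrite Rintegral_lincomb// mulNr.
- rewrite cImM/=; under eq_Rintegral do rewrite cImM.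
  by rewrite Rintegral_lincomb.
Qed.

Lemma CintegralB A u v : measurable A -> cintegrable A u -> cintegrable A v ->
  Cintegral A (fun x => u x - v x) = Cintegral A u - Cintegral A v.
Proof.
move=> mA [u1 u2] [v1 v2]; apply: complexP.
- rewrite cReB/=; under eq_Rintegral do rewrite cReB.
  by rewrite RintegralB.
- rewrite cImB/=; under eq_Rintegral do rewrite cImB.
  by rewrite RintegralB.
Qed.

(** With [z] the value of the integral, [|z| ^ 2] is the integral of [Re (z^* u)], which is at most
    [|z| g] pointwise. *)
Lemma modulus_Cintegral_le A u g : measurable A -> cintegrable A u ->
  leb.-integrable A (EFin \o g) -> (forall x, A x -> modulus (u x) <= g x) ->
  modulus (Cintegral A u) <= \int[leb]_(x in A) g x.
Proof.
move=> mA [u1 u2] gi ug; set z := Cintegral A u.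
have zR : \int[leb]_(x in A) complex.Re (u x) = complex.Re z by [].
have zI : \int[leb]_(x in A) complex.Im (u x) = complex.Im z by [].
(* From here on [z] is an opaque constant, so that only the chosen occurrences of its parts are
   turned back into integrals. *)
clearbody z; apply: modulus_le_proj.
  by apply: Rintegral_ge0 => x Ax; rewrite (le_trans _ (ug _ Ax))// modulus_ge0.
rewrite -[X in modulus z * X]/(\int[leb]_(x in A) g x) -RintegralZl//.
rewrite -{2}zR -{2}zI -Rintegral_lincomb//.
apply: le_Rintegral => //.
- exact: integrable_lincomb.
- have : leb.-integrable A (fun x => (modulus z)%:E * (g x)%:E)%E.
    exact: integrableZl.
  exact.
- move=> x Ax; rewrite (le_trans (Re_conjM_le _ _))// ler_wpM2l ?modulus_ge0//.
  exact: ug.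
Qed.

Lemma Cintegral_decay_FTC2y u (U : R -> R[i]) (c d : R) : ccontinuous_on setT u ->
  (forall x, 0 <= x -> modulus (u x) <= c * expR (- x)) ->
  (forall x, is_cderive U x (u x)) ->
  (forall x, 0 <= x -> modulus (U x) <= d * expR (- x)) ->
  Cintegral `]0, +oo[ u = - U 0.
Proof.
move=> /ccontinuous_setT[cu1 cu2] uc dU Ud.
have dcvg : (d * expR (- x)) @[x --> +oo] --> (0 : R).
  by rewrite -(mulr0 d); apply: cvgM; [exact: cvg_cst|exact: cvgr_expR].
have sq (f : R -> R) : (forall x, `|f x| <= modulus
  (U x)) -> f x @[x --> +oo] --> (0 : R).
  move=> fU; apply: norm_cvg0; apply: (squeeze_cvgr _ (cvg_cst 0) dcvg).
  near=> x; have x0 : 0 <= x by near: x; apply: nbhs_pinfty_ge; rewrite num_real.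
  by rewrite normr_ge0/= (le_trans (fU x))// Ud.
rewrite (_ : - U 0 = (- complex.Re (U 0)) +i* (- complex.Im (U 0))); last first.
  by case: (U 0).
congr Complex.
- apply: (Rintegral_decay_FTC2y cu1 _ (fun x => proj1 (dU x)) _ (c := c)).
  + by move=> x x0; rewrite (le_trans (Re_le_modulus _))// uc.
  + by apply: sq => x; exact: Re_le_modulus.
- apply: (Rintegral_decay_FTC2y cu2 _ (fun x => proj2 (dU x)) _ (c := c)).
  + by move=> x x0; rewrite (le_trans (Im_le_modulus _))// uc.
  + by apply: sq => x; exact: Im_le_modulus.
Unshelve. all: end_near. Qed.

Lemma is_derive_under_integral A (f df : R -> R -> R) (g : R -> R) (a b x : R) :
  measurable A -> a < x < b ->
  (forall t, a < t < b -> leb.-integrable A (EFin \o f t)) ->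
  (forall t y, a < t < b -> A y -> is_derive t 1 (f ^~ y) (df t y)) ->
  leb.-integrable A (EFin \o g) ->
  (forall t y, a < t < b -> A y -> `|df t y| <= g y) ->
  is_derive x 1 (fun t => \int[leb]_(y in A) f t y) (\int[leb]_(y in A) df x y).
Proof.
move=> mA xab fi fd gi fg.
have gi' : leb.-integrable A (EFin \o (Num.norm \o g)) by exact: integrable_norm.
have xI : `]a, b[%classic x by rewrite /= in_itv.
have fi' t : `]a, b[%classic t -> leb.-integrable A (EFin \o f t).
  by rewrite /= in_itv/=; exact: fi.
have fd' t y : `]a, b[%classic t -> A y -> derivable (f ^~ y) t 1.
  by rewrite /= in_itv/= => tab Ay; have := fd _ _ tab Ay => ?; exact: ex_derive.
have dE t y : `]a, b[%classic t -> A y -> partial1of2 f t y = df t y.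
  rewrite /= in_itv/= => tab Ay; have := fd _ _ tab Ay => ?.
  by rewrite partial1of2E derive_val.
have fg' t y : `]a, b[%classic t -> A y -> `|partial1of2 f t y| <=
  (Num.norm \o g) y.
  move=> tI Ay; rewrite dE//=; move: tI; rewrite /= in_itv/= => tab.
  by rewrite (le_trans (fg _ _ tab Ay))// ler_norm.
have g0 y : 0 <= (Num.norm \o g) y by exact: normr_ge0.
have D := derivable_under_integral mA xI fi' fd' g0 gi' fg'.
apply: DeriveDef => //.
rewrite -derive1E (differentiation_under_integral mA xI fi' fd' g0 gi' fg').
by apply: eq_Rintegral => y /set_mem Ay; rewrite dE.
Qed.

Lemma is_cderive_under_integral A (u du : R -> R -> R[i]) (g : R -> R) (a b x : R) :
  measurable A -> a < x < b ->
  (forall t, a < t < b -> cintegrable A (u t)) ->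
  (forall t y, a < t < b -> A y -> is_cderive (u ^~ y) t (du t y)) ->
  leb.-integrable A (EFin \o g) ->
  (forall t y, a < t < b -> A y -> modulus (du t y) <= g y) ->
  is_cderive (fun t => Cintegral A (u t)) x (Cintegral A (du x)).
Proof.
move=> mA xab ui ud gi ug; split => /=.
- apply: (is_derive_under_integral mA xab _
    (fun t y tab Ay => proj1 (ud t y tab Ay)) gi).
  + by move=> t /ui [].
  + by move=> t y tab Ay; rewrite (le_trans (Re_le_modulus _))// ug.
- apply: (is_derive_under_integral mA xab _
    (fun t y tab Ay => proj2 (ud t y tab Ay)) gi).
  + by move=> t /ui [].
  + by move=> t y tab Ay; rewrite (le_trans (Im_le_modulus _))// ug.
Qed.

Lemma ccontinuous_under_integral A (u : R -> R -> R[i]) (g : R -> R) :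
  measurable A -> (forall t, cintegrable A (u t)) ->
  (forall y, A y -> ccontinuous_on setT (u ^~ y)) ->
  leb.-integrable A (EFin \o g) ->
  (forall t y, A y -> modulus (u t y) <= g y) ->
  ccontinuous_on setT (fun t => Cintegral A (u t)).
Proof.
move=> mA ui uc gi ug; apply/ccontinuous_setT; split=> x.
- apply: (@continuity_under_integral _ _ _ leb (fun t y => complex.Re (u t y)) A mA
    (x - 1) (x + 1) _ _ g gi).
  + by move=> t _; case: (ui t).
  + apply: aeW => y Ay t _; have /ccontinuous_setT[H _] := uc y Ay.
    exact: H.
  + by move=> t _; apply: aeW => y Ay; rewrite (le_trans (Re_le_modulus _))// ug.
  + by rewrite inE/= in_itv/= ltrBlDr ltrDl ltr01.
- apply: (@continuity_under_integral _ _ _ leb (fun t y => complex.Im (u t y)) A mA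
    (x - 1) (x + 1) _ _ g gi).
  + by move=> t _; case: (ui t).
  + apply: aeW => y Ay t _; have /ccontinuous_setT[_ H] := uc y Ay.
    exact: H.
  + by move=> t _; apply: aeW => y Ay; rewrite (le_trans (Im_le_modulus _))// ug.
  + by rewrite inE/= in_itv/= ltrBlDr ltrDl ltr01.
Qed.

End ComplexIntegrals.

(** * Powers of [v + i r] and their derivatives along both axes *)

Section ComplexPower.
Context {R : realType}.
Implicit Types (b v r x : R).

(* The principal value of [(v + i r) ^ b] for [r > 0]: the argument of
   [v + i r] is written [pi / 2 - atan (v / r)] so that it is smooth in [v]
   on the whole line. *)
Definition cpow b v r : R[i] :=
  ((v ^+ 2 + r ^+ 2) `^ (b / 2))%:C * expi (b * (pi / 2 - atan (v / r))).

(* The same power for [v > 0], with an argument that is smooth in [r]. *)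
Definition cpow_right b v r : R[i] :=
  ((v ^+ 2 + r ^+ 2) `^ (b / 2))%:C * expi (b * atan (r / v)).

(* [(v + i r)^-1] *)
Definition cinvert v r : R[i] :=
  (v / (v ^+ 2 + r ^+ 2)) +i* (- (r / (v ^+ 2 + r ^+ 2))).

Lemma modulus_cpow b v r : modulus (cpow b v r) = (v ^+ 2 + r ^+ 2) `^ (b / 2).
Proof. by rewrite modulusM modulus_expi mulr1 modulus_real ger0_norm//
  powR_ge0. Qed.

Lemma modulus_cpow_right b v r :
  modulus (cpow_right b v r) = (v ^+ 2 + r ^+ 2) `^ (b / 2).
Proof. by rewrite modulusM modulus_expi mulr1 modulus_real ger0_norm//
  powR_ge0. Qed.

Lemma modulus_cinvert v r : 0 < v ^+ 2 + r ^+ 2 ->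
  modulus (cinvert v r) = (v ^+ 2 + r ^+ 2) `^ (- 2^-1).
Proof.
set s := v ^+ 2 + r ^+ 2 => s0.
rewrite powRN powR12_sqrt ?ltW// -sqrtrV ?ltW//; congr Num.sqrt.
rewrite sqrrN !expr_div_n -mulrDl -/s expr2 invfM mulrA divff ?mul1r//.
exact: lt0r_neq0.
Qed.

Lemma atan_inv x : 0 < x -> pi / 2 - atan x = atan x^-1.
Proof.
move=> x0; apply: tan_inj.
- rewrite in_itv/= ltrBrDr ltrBlDr.
  have := atan_ltpi2 x; have : 0 < atan x by rewrite -atan0 lt_atan.
  by have := @pi_gt0 R => *; apply/andP; split; lra.
- by rewrite in_itv/= atan_gtNpi2 atan_ltpi2.
rewrite atanK /tan -{3}[x]atanK /tan invf_div.
by rewrite [pi / 2 - _]addrC sinDpihalf cosDpihalf sinN cosN opprK.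
Qed.

Lemma cpow_rightE b v r : 0 < v -> 0 < r -> cpow b v r = cpow_right b v r.
Proof.
by move=> v0 r0; rewrite /cpow /cpow_right atan_inv ?divr_gt0// invf_div.
Qed.

Lemma cpow_right0 b v : 0 < v -> cpow_right b v 0 = (v `^ b)%:C.
Proof.
move=> v0; rewrite /cpow_right mul0r atan0 mulr0 expi0 mulr1 expr0n/= addr0.
by rewrite -powR_mulrn ?(ltW v0)// -powRrM mulrCA divff// mulr1.
Qed.

Lemma cpow0 b r : 0 < r -> cpow b 0 r = (r `^ b)%:C * expi (b * (pi / 2)).
Proof.
move=> r0; rewrite /cpow mul0r atan0 subr0 expr0n/= add0r.
by rewrite -powR_mulrn ?(ltW r0)// -powRrM mulrCA divff// mulr1.
Qed.

Lemma is_derive_sumsq_powR b c x : 0 < x ^+ 2 + c ^+ 2 ->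
  is_derive x 1 (fun t => (t ^+ 2 + c ^+ 2) `^ (b / 2))
    (b * (x / (x ^+ 2 + c ^+ 2)) * (x ^+ 2 + c ^+ 2) `^ (b / 2)).
Proof.
move=> s0.
have d : is_derive x 1 (fun t => t ^+ 2 + c ^+ 2) (2 * x).
  apply: (is_derive_eq (is_deriveD (is_deriveX 2 (is_derive_id x 1))
    (is_derive_cst (c ^+ 2) x 1))).
  by rewrite /GRing.scale/= mulr1 addr0 expr1 mulr_natl.
apply: (is_derive_eq (is_derive_powR_comp (f := fun t => t ^+ 2 + c ^+ 2)
  (b / 2) s0 d)).
rewrite powRB ?lt0r_neq0 ?implybT// powRr1 ?ltW//.
by field; exact: lt0r_neq0.
Qed.

Lemma is_cderive_cpow b v r : 0 < r ->
  is_cderive (fun t => cpow b t r) v (b%:C * cinvert v r * cpow b v r).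
Proof.
move=> r0; set s := v ^+ 2 + r ^+ 2.
have s0 : 0 < s by rewrite ltr_wpDl ?sqr_ge0// exprn_gt0.
have dm := is_cderive_real (is_derive_sumsq_powR b s0).
have dT : is_derive v 1 (fun t => b * (pi / 2 - atan (t / r))) (- (b * (r / s))).
  have d1 : is_derive v 1 (fun t => t / r) r^-1.
    apply: (is_derive_eq (is_deriveM (is_derive_id v 1) (is_derive_cst r^-1 v 1))).
    by rewrite scaler0 add0r /GRing.scale/= mulr1.
  have d2 := is_derive1_comp (g := fun t => t / r) (is_derive1_atan (v / r)) d1.
  apply: (is_derive_eq (is_deriveZ b (is_deriveB (is_derive_cst (pi / 2) v 1) d2))).
  rewrite sub0r /GRing.scale/= mulrN; congr (- (_ * _)); rewrite /s.
  by field; rewrite !lt0r_neq0//= addrC.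
have := is_cderiveM dm (is_cderive_comp dT (is_cderive_expi _)).
move/is_cderive_eq; apply; rewrite /cpow -/s.
set X := s `^ _; set E := expi _.
have -> : cinvert v r = (v / s)%:C - 'i%C * (r / s)%:C.
  by apply: complexP; rewrite ?cReB ?cImB ?cReM ?cImM/= -/s; ring.
by rewrite !rmorphM/= rmorphN !rmorphM/=; ring.
Qed.

Lemma is_cderive_cpow_right b v r : 0 < v ->
  is_cderive (fun t => cpow_right b v t) r ('i%C *
    (b%:C * cinvert v r * cpow_right b v r)).
Proof.
move=> v0; set s := v ^+ 2 + r ^+ 2.
have s0 : 0 < s by rewrite ltr_wpDr ?sqr_ge0// exprn_gt0.
have dm : is_cderive (fun t => ((v ^+ 2 + t ^+ 2) `^ (b / 2))%:C) r
    (b * (r / s) * s `^ (b / 2))%:C.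
  apply: is_cderive_real; have := @is_derive_sumsq_powR b v r.
  by under eq_fun do rewrite addrC; rewrite addrC; apply.
have dT : is_derive r 1 (fun t => b * atan (t / v)) (b * (v / s)).
  have d1 : is_derive r 1 (fun t => t / v) v^-1.
    apply: (is_derive_eq (is_deriveM (is_derive_id r 1) (is_derive_cst v^-1 r 1))).
    by rewrite scaler0 add0r /GRing.scale/= mulr1.
  have d2 := is_derive1_comp (g := fun t => t / v) (is_derive1_atan (r / v)) d1.
  apply: (is_derive_eq (is_deriveZ b d2)).
  rewrite /GRing.scale/=; congr (_ * _); rewrite /s.
  by field; rewrite !lt0r_neq0//=.
have := is_cderiveM dm (is_cderive_comp dT (is_cderive_expi _)).
move/is_cderive_eq; apply; rewrite /cpow_right -/s.
set X := s `^ _; set E := expi _.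
have -> : cinvert v r = (v / s)%:C - 'i%C * (r / s)%:C.
  by apply: complexP; rewrite ?cReB ?cImB ?cReM ?cImM/= -/s; ring.
have i2 : 'i%C * 'i%C = -1 :> R[i] by rewrite -expr2 sqr_i.
transitivity (b%:C * X%:C * E * ((v / s)%:C * 'i%C - ('i%C * 'i%C) * (r / s)%:C)).
  by rewrite i2 !rmorphM/=; ring.
by rewrite !rmorphM/=; ring.
Qed.

End ComplexPower.

(** * The absolutely convergent integral along the rotated half-line *)

Section RayIntegral.
Context {R : realType}.
Variable a : R.
Hypotheses (a0 : 0 < a) (a1 : a <= 1).
Local Notation leb := (@lebesgue_measure R).
Implicit Types (v r : R).

(* [\int_0^oo (v + i r) ^ (a - 1) e ^ (- r) dr] *)
Definition ray_integral v : R[i] :=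
  Cintegral `]0, +oo[ (fun r => cpow (a - 1) v r * (expR (- r))%:C).

Let am1 : a - 1 <= 0. Proof. by rewrite subr_le0. Qed.

Let sumsq_gt0 v r : 0 < r -> 0 < v ^+ 2 + r ^+ 2.
Proof. by move=> r0; rewrite ltr_wpDl ?sqr_ge0// exprn_gt0. Qed.

Let sumsq_gt0l v r : 0 < v -> 0 < v ^+ 2 + r ^+ 2.
Proof. by move=> v0; rewrite ltr_wpDr ?sqr_ge0// exprn_gt0. Qed.

Let sqr_powR (b r : R) : 0 < r -> (r ^+ 2) `^ (b / 2) = r `^ b.
Proof.
by move=> r0; rewrite -powR_mulrn ?(ltW r0)// -powRrM mulrCA divff// mulr1.
Qed.

Let sumsq_powR_le (b v r : R) : b <= 0 -> 0 < r -> (v ^+ 2 + r ^+ 2) `^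
  (b / 2) <= r `^ b.
Proof.
move=> b0 r0; rewrite -(sqr_powR b r0) le0_ler_powR ?posrE ?sumsq_gt0 ?exprn_gt0//.
  by rewrite pmulr_lle0// invr_gt0.
by rewrite lerDr sqr_ge0.
Qed.

Let sumsq_powR_lel (b v r : R) : b <= 0 -> 0 < v -> (v ^+ 2 + r ^+ 2) `^
  (b / 2) <= v `^ b.
Proof. by rewrite addrC; exact: sumsq_powR_le. Qed.

Let modulus_weight (z : R[i]) r : modulus (z * (expR
  (- r))%:C) = modulus z * expR (- r).
Proof. by rewrite modulusM modulus_real ger0_norm// expR_ge0. Qed.

Let measurable_sumsq_powR (A : set (measurableTypeR R)) (b v : R) :
  measurable_fun A (fun r => (v ^+ 2 + r ^+ 2) `^ b).
Proof.
apply: (@measurableT_comp _ _ _ _ _ _ (@powR R ^~ b)); first exact: measurable_powR.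
by apply: measurable_funD => //; apply: measurable_funX.
Qed.

Let cmeasurable_ray_integrand v :
  cmeasurable `]0, +oo[ (fun r => cpow (a - 1) v r * (expR (- r))%:C).
Proof.
apply: cmeasurableM; last first.
  by apply: cmeasurable_real; apply: measurableT_comp => //;
    exact: measurableT_comp.
apply: cmeasurableM; first by apply: cmeasurable_real; exact: measurable_sumsq_powR.
apply: cmeasurable_expi; apply: subspace_continuous_measurable_fun => //.
apply: continuous_in_subspaceT => r; rewrite inE/= in_itv/= andbT => r0.
apply: cvgM; first exact: cvg_cst.
apply: cvgB; first exact: cvg_cst.
apply: (continuous_comp (f := fun r => v / r)); last exact: continuous_atan.
by apply: cvgM; [exact: cvg_cst|apply: cvgV; [exact: lt0r_neq0|exact: cvg_id]].
Qed.

Let ray_integrand_le v r : 0 < r ->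
  modulus (cpow (a - 1) v r * (expR (- r))%:C) <= r `^ (a - 1) * expR (- r).
Proof.
by move=> r0; rewrite modulus_weight modulus_cpow ler_wpM2r ?expR_ge0//
  sumsq_powR_le.
Qed.

Let cintegrable_ray v :
  cintegrable `]0, +oo[ (fun r => cpow (a - 1) v r * (expR (- r))%:C).
Proof.
apply: cintegrable_le (integrable_Gamma a0 a1) _ => // r.
by rewrite /= in_itv/= andbT; exact: ray_integrand_le.
Qed.

(** Since [a <= 1], the inequality [|v + i r| >= r] bounds the integrand by that of [Gamma a],
    uniformly in [v]. The same domination gives continuity at [v = 0]. *)
Lemma ray_integral_le_Gamma v : modulus (ray_integral v) <= Gamma a.
Proof.
apply: modulus_Cintegral_le (integrable_Gamma a0 a1) _ => // r.
by rewrite /= in_itv/= andbT; exact: ray_integrand_le.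
Qed.

Lemma ccontinuous_ray_integral : ccontinuous_on setT ray_integral.
Proof.
apply: ccontinuous_under_integral (integrable_Gamma a0 a1) _ => //.
- move=> r; rewrite /= in_itv/= andbT => r0.
  rewrite -set_itvNyy; apply: is_cderive_ccontinuous => v _.
  exact: is_cderiveM (is_cderive_cpow (a - 1) v r0) (is_cderive_cst _ _).
- by move=> v r; rewrite /= in_itv/= andbT; exact: ray_integrand_le.
Qed.

Lemma ray_integral0 : ray_integral 0 = (Gamma a)%:C * expi ((a - 1) * (pi / 2)).
Proof.
set E := expi _; rewrite mulrC.
have gi : cintegrable `]0, +oo[ (fun r => (r `^ (a - 1) * expR (- r))%:C).
  split; first exact: integrable_Gamma.
  by rewrite /=; exact: integrable0.
rewrite (_ : (Gamma a)%:C = Cintegral `]0, +oo[ (fun r => (r `^ (a - 1) * expR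
  (- r))%:C)).
  rewrite -CintegralZ//; apply: eq_Cintegral => r.
  rewrite /= in_itv/= andbT => r0.
  by rewrite cpow0// rmorphM/= -/E; ring.
apply: complexP => //=.
by rewrite /Rintegral integral0_eq.
Qed.

(** The competing inequality [|v + i r| >= v], with [exp (- r)] of total mass 1, gives the decay for
    large [v]. *)
Lemma ray_integral_le_powR v : 0 < v -> modulus (ray_integral v) <= v `^ (a - 1).
Proof.
move=> v0.
have H : leb.-integrable `]0, +oo[ (EFin \o (fun r => v `^ (a - 1) * expR (- r))).
  exact: integrableZ_expRN.
have -> : v `^ (a - 1) = \int[leb]_(r in `]0, +oo[) (v `^ (a - 1) * expR (- r)).
  rewrite RintegralZl// ?Rintegral_expRN ?mulr1//.
  by apply: integrableS integrable_expRN => //; apply: subset_itvr;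
    rewrite bnd_simp.
apply: modulus_Cintegral_le => // r _.
by rewrite modulus_weight modulus_cpow ler_wpM2r ?expR_ge0// sumsq_powR_lel.
Qed.

(** For [r > 0] this is the derivative in [v] of the integrand. It is written with [cpow_right]
    because the integration by parts in [r] below starts at [r = 0], where the argument
    [atan (v / r)] in [cpow] is not smooth. *)
Let dray v r : R[i] :=
  (a - 1)%:C * cinvert v r * cpow_right (a - 1) v r * (expR (- r))%:C.

Let modulus_dray (z : R[i]) v r : 0 < v ->
  modulus z = (v ^+ 2 + r ^+ 2) `^ ((a - 1) / 2) ->
  modulus ((a - 1)%:C * cinvert v r * z) <= (1 - a) * v `^ (a - 2).
Proof.
move=> v0 zE; rewrite 2!modulusM modulus_real modulus_cinvert ?sumsq_gt0l// zE.
rewrite ler0_norm// opprB -mulrA ler_wpM2l ?subr_ge0// -powRD; last first.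
  by rewrite lt0r_neq0 ?implybT// sumsq_gt0l.
rewrite (_ : - 2^-1 + _ = (a - 2) / 2); last by field.
by rewrite sumsq_powR_lel//; move: a1; lra.
Qed.

Let ccontinuous_dray v : 0 < v -> ccontinuous_on setT (dray v).
Proof.
move=> v0; apply: ccontinuous_onM.
  apply: ccontinuous_onM.
    apply: ccontinuous_onM; first exact: ccontinuous_on_cst.
    have cv : continuous (fun r : R => (v ^+ 2 + r ^+ 2)^-1).
      move=> r; apply: cvgV; first by rewrite lt0r_neq0 ?sumsq_gt0l.
      by apply: cvgD; [exact: cvg_cst|exact: exprn_continuous].
    apply/ccontinuous_setT; split=> r/=.
      by apply: cvgM; [exact: cvg_cst|exact: cv].
    by apply: cvgN; apply: cvgM; [exact: cvg_id|exact: cv].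
  by rewrite -set_itvNyy; apply: is_cderive_ccontinuous => r _;
    exact: is_cderive_cpow_right.
apply: ccontinuous_on_real; apply: continuous_subspaceT => r.
by apply: continuous_comp; [exact: continuousN|exact: continuous_expR].
Qed.

Let dray_le v r : 0 < v -> modulus (dray v r) <= (1 - a) * v `^ (a - 2) * expR
  (- r).
Proof.
by move=> v0; rewrite modulus_weight ler_wpM2r ?expR_ge0// modulus_dray
  ?modulus_cpow_right.
Qed.

Let cintegrable_dray v : 0 < v -> cintegrable `]0, +oo[ (dray v).
Proof.
move=> v0; apply: cintegrable_le (integrableZ_expRN _) _ => //.
- by apply: ccontinuous_cmeasurable => //;
    exact: ccontinuous_on_subset (ccontinuous_dray v0).
- by move=> r _; exact: dray_le.
Qed.

(** Integration by parts in [r]. The power is holomorphic in [v + i r], so its derivative in [r] is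
    [i] times that in [v], and [W r = (v + i r) ^ (a - 1) exp (- r)] satisfies [W' = i * dray - W].
    Integrating from 0 leaves [- W 0 = - v ^ (a - 1)]. Both the asymptotics and the differential
    equation of [ray_integral] follow. *)
Lemma Cintegral_dray v : 0 < v ->
  'i%C * Cintegral `]0, +oo[ (dray v) = ray_integral v - (v `^ (a - 1))%:C.
Proof.
move=> v0.
have cr : ccontinuous_on setT (cpow_right (a - 1) v).
  by rewrite -set_itvNyy; apply: is_cderive_ccontinuous => r _;
    exact: is_cderive_cpow_right.
have ce : ccontinuous_on setT (fun r : R => (expR (- r))%:C).
  apply: ccontinuous_on_real; apply: continuous_subspaceT => r.
  by apply: continuous_comp; [exact: continuousN|exact: continuous_expR].
pose u r := 'i%C * dray v r + (-1) * (cpow_right (a - 1) v r * (expR (- r))%:C).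
have cu : ccontinuous_on setT u.
  apply: ccontinuous_onD; apply: ccontinuous_onM; try exact: ccontinuous_on_cst.
    exact: ccontinuous_dray.
  exact: ccontinuous_onM.
pose W r := cpow_right (a - 1) v r * (expR (- r))%:C.
have W_le r : modulus (W r) <= v `^ (a - 1) * expR (- r).
  by rewrite modulus_weight modulus_cpow_right ler_wpM2r ?expR_ge0// sumsq_powR_lel.
have u_le r : 0 <= r ->
    modulus (u r) <= ((1 - a) * v `^ (a - 2) + v `^ (a - 1)) * expR (- r).
  move=> _; rewrite (le_trans (modulusD _ _))// mulrDl lerD//.
    by rewrite modulusM modulus_i mul1r dray_le.
  by rewrite mulN1r modulusN W_le.
have dW r : is_cderive W r (u r).
  have de : is_derive r 1 (fun t => expR (- t)) (- expR (- r)).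
    by apply: is_derive_eq; rewrite /GRing.scale/= mulrN1.
  have := is_cderiveM (is_cderive_cpow_right (a - 1) r v0) (is_cderive_real de).
  by move/is_cderive_eq; apply; rewrite rmorphN/= /u /dray; ring.
have uE : Cintegral `]0, +oo[ u = 'i%C * Cintegral `]0, +oo[
  (dray v) - ray_integral v.
  have iZ := cintegrableZ 'i%C (@measurable_itv R `]0, +oo[) (cintegrable_dray v0).
  rewrite -CintegralZ//; last exact: cintegrable_dray.
  rewrite /ray_integral -(CintegralB _ iZ (cintegrable_ray v))//.
  apply: eq_Cintegral => r; rewrite /= in_itv/= andbT => r0.
  by rewrite /u cpow_rightE// mulN1r.
have WE : W 0 = (v `^ (a - 1))%:C by rewrite /W cpow_right0// oppr0 expR0 mulr1.
have := Cintegral_decay_FTC2y cu u_le dW (fun r _ => W_le r).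
rewrite uE WE; move/eqP; rewrite subr_eq => /eqP ->.
exact: addrC.
Qed.

Lemma ray_integral_asymp v : 0 < v ->
  modulus (ray_integral v - (v `^ (a - 1))%:C) <= (1 - a) * v `^ (a - 2).
Proof.
move=> v0; rewrite -Cintegral_dray// modulusM modulus_i mul1r.
have -> : (1 - a) * v `^ (a - 2) =
    \int[leb]_(r in `]0, +oo[) ((1 - a) * v `^ (a - 2) * expR (- r)).
  rewrite RintegralZl// ?Rintegral_expRN ?mulr1//.
  by apply: integrableS integrable_expRN => //; apply: subset_itvr;
    rewrite bnd_simp.
apply: modulus_Cintegral_le (integrableZ_expRN _) _ => //.
  exact: cintegrable_dray.
by move=> r _; exact: dray_le.
Qed.

Lemma is_cderive_ray_integral v : 0 < v ->
  is_cderive ray_integral v (- 'i%C * (ray_integral v - (v `^ (a - 1))%:C)).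
Proof.
move=> v0; rewrite -Cintegral_dray// mulNr mulrA -expr2 sqr_i mulN1r opprK.
have -> : Cintegral `]0, +oo[ (dray v) = Cintegral `]0, +oo[ (fun r =>
    (a - 1)%:C * cinvert v r * cpow (a - 1) v r * (expR (- r))%:C).
  by apply: eq_Cintegral => r; rewrite /= in_itv/= andbT => r0; rewrite cpow_rightE.
(* The window []v / 2, v + 1[] keeps the parameter away from 0, so that
   [(v / 2) ^ (a - 2) exp (- r)], up to the factor [1 - a], dominates uniformly. *)
apply: (@is_cderive_under_integral _ _ _ (fun t r =>
  (a - 1)%:C * cinvert t r * cpow (a - 1) t r * (expR (- r))%:C) (fun r =>
  (1 - a) * (v / 2) `^ (a - 2) * expR (- r)) (v / 2) (v + 1)) => //.
- by apply/andP; split; lra.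
- move=> t r _; rewrite /= in_itv/= andbT => r0.
  have := is_cderiveM (is_cderive_cpow (a - 1) t r0) (is_cderive_cst (expR
    (- r))%:C t).
  by move/is_cderive_eq; apply; rewrite mulr0 addr0.
- exact: integrableZ_expRN.
- move=> t r /andP[vt _] _; have t0 : 0 < t by apply: lt_trans vt; lra.
  rewrite modulus_weight ler_wpM2r ?expR_ge0//.
  rewrite (le_trans (modulus_dray t0 (modulus_cpow _ _ _)))//.
  rewrite ler_wpM2l ?subr_ge0// le0_ler_powR ?posrE//; [move: a1;
    lra|lra|exact: ltW].
Qed.

End RayIntegral.

(** * Oscillatory tails with a power weight, and Fresnel tails *)

Section OscillatoryTail.
Context {R : realType}.
Implicit Types (a w v t : R).

(* [\int_v^oo x ^ (a - 1) e ^ (i w x) dx], with the path of integration rotated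
   to the half-line [v + i r]. *)
Definition osc_tail a w v : R[i] :=
  (w `^ (- a))%:C * ('i%C * expi (w * v) * ray_integral a (w * v)).

Section Estimates.
Variables (a w : R).
Hypotheses (a0 : 0 < a) (a1 : a <= 1) (w0 : 0 < w).

Let wM v (b c : R) : 0 < v -> w `^ b * (w * v) `^ c = w `^ (b + c) * v `^ c.
Proof.
move=> v0; rewrite powRM ?ltW// mulrA -powRD//.
by rewrite lt0r_neq0 ?implybT.
Qed.

Let modulus_osc_factor v : modulus ('i%C * expi (w * v)) = 1.
Proof. by rewrite modulusM modulus_i modulus_expi mulr1. Qed.

Lemma osc_tail_le v : 0 < v -> modulus (osc_tail a w v) <= w^-1 * v `^ (a - 1).
Proof.
move=> v0; rewrite modulusM modulus_real ger0_norm ?powR_ge0//.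
rewrite modulusM modulus_osc_factor mul1r.
have -> : w^-1 * v `^ (a - 1) = w `^ (- a) * (w * v) `^ (a - 1).
  by rewrite wM// addKr powR_inv1// ltW.
by rewrite ler_wpM2l ?powR_ge0// ray_integral_le_powR// mulr_gt0.
Qed.

Lemma osc_tail_le_Gamma v : modulus (osc_tail a w v) <= w `^ (- a) * Gamma a.
Proof.
rewrite modulusM modulus_real ger0_norm ?powR_ge0//.
rewrite modulusM modulus_osc_factor mul1r.
by rewrite ler_wpM2l ?powR_ge0// ray_integral_le_Gamma.
Qed.

Lemma osc_tail_asymp v : 0 < v ->
  modulus (osc_tail a w v - 'i%C * expi (w * v) * (w^-1 * v `^ (a - 1))%:C)
  <= (1 - a) * (w `^ (-2) * v `^ (a - 2)).
Proof.
move=> v0.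
have -> : w^-1 * v `^ (a - 1) = w `^ (- a) * (w * v) `^ (a - 1).
  by rewrite wM// addKr powR_inv1// ltW.
rewrite real_complexM [X in _ - X]mulrCA -mulrBr -mulrBr modulusM modulus_real.
rewrite ger0_norm ?powR_ge0// modulusM modulus_osc_factor mul1r.
have -> : (1 - a) * (w `^ (-2) * v `^ (a - 2)) =
    w `^ (- a) * ((1 - a) * (w * v) `^ (a - 2)).
  by rewrite [RHS]mulrCA wM// addKr.
by rewrite ler_wpM2l ?powR_ge0// ray_integral_asymp// mulr_gt0.
Qed.

(** By its differential equation, the derivative of [ray_integral] contains [- i] times itself. This
    cancels the term coming from differentiating [expi (w * v)], and only the original integrand
    remains. *)
Lemma is_cderive_osc_tail v : 0 < v ->
  is_cderive (osc_tail a w) v (- ((v `^ (a - 1))%:C * expi (w * v))).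
Proof.
move=> v0; have wv0 : 0 < w * v by rewrite mulr_gt0.
have dw : is_derive v 1 (fun t => w * t) w.
  by apply: (is_derive_eq (is_deriveZ w (is_derive_id v 1)));
    rewrite /GRing.scale/= mulr1.
have dP := is_cderive_comp dw (is_cderive_ray_integral a0 a1 wv0).
have dE := is_cderiveZ 'i%C (is_cderive_comp dw (is_cderive_expi (w * v))).
apply: (is_cderive_eq (is_cderiveZ (w `^ (- a))%:C (is_cderiveM dE dP))).
have -> : v `^ (a - 1) = w `^ (- a) * w * (w * v) `^ (a - 1).
  rewrite mulrAC wM// addKr powRN powRr1 ?(ltW w0)// mulrAC mulVf ?mul1r//.
  exact: lt0r_neq0.
rewrite !real_complexM; cbv beta;
  have i2 : 'i%C * 'i%C = -1 :> R[i] by rewrite -expr2 sqr_i.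
set P := ray_integral _ _; set E := expi _; set W := (w `^ _)%:C.
set V := ((w * v) `^ _)%:C.
transitivity (('i%C * 'i%C) * (W * w%:C * E * V)); last by rewrite i2; ring.
by ring.
Qed.

Lemma ccontinuous_osc_tail : ccontinuous_on setT (osc_tail a w).
Proof.
have cw : {within setT, continuous (fun t : R => w * t)}.
  by apply: continuous_subspaceT => t; apply: cvgM; [exact: cvg_cst|exact: cvg_id].
apply: ccontinuous_onM; first exact: ccontinuous_on_cst.
apply: ccontinuous_onM.
  apply: ccontinuous_onM; first exact: ccontinuous_on_cst.
  by apply: ccontinuous_on_comp => //; exact: ccontinuous_expi.
by apply: ccontinuous_on_comp => //; exact: ccontinuous_ray_integral.
Qed.

Lemma osc_tail0 : osc_tail a w 0 = (w `^ (- a) * Gamma a)%:C * expi (pi * a / 2).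
Proof.
rewrite /osc_tail mulr0 expi0 mulr1 ray_integral0// real_complexM.
have -> : 'i%C = expi (pi / 2) :> R[i] by rewrite /expi cos_pihalf sin_pihalf.
rewrite -[RHS]mulrA; congr (_ * _); rewrite mulrCA -expiD; congr (_ * expi _).
by field.
Qed.

End Estimates.

(* [\int_t^oo e ^ (- i w x ^ 2) dx] *)
Definition fresnel_tail w t : R[i] := 2^-1%:C * (osc_tail (1 / 2) w (t ^+ 2))^*%C.

Section Fresnel.
Variable w : R.
Hypothesis w0 : 0 < w.

Let h0 : 0 < 1 / 2 :> R. Proof. by lra. Qed.
Let h1 : 1 / 2 <= 1 :> R. Proof. by lra. Qed.

Let sqr_powR (b r : R) : 0 < r -> (r ^+ 2) `^ b = r `^ (2 * b).
Proof. by move=> r0; rewrite -powR_mulrn ?(ltW r0)// -powRrM. Qed.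

Let modulus_half (z : R[i]) : modulus (2^-1%:C * z^*%C) = 2^-1 * modulus z.
Proof. by rewrite modulusM modulus_real modulus_conj ger0_norm// invr_ge0. Qed.

(** In the substitution [y = x ^ 2] the chain factor [2 t] is compensated by [1 / 2] and by the
    weight [(t ^ 2) ^ (- 1 / 2) = 1 / t]. *)
Lemma is_cderive_fresnel_tail t : 0 < t ->
  is_cderive (fresnel_tail w) t (- expi (- (w * t ^+ 2))).
Proof.
move=> t0; have t20 : 0 < t ^+ 2 by rewrite exprn_gt0.
have dt : is_derive t 1 (fun x => x ^+ 2) (2 * t).
  apply: (is_derive_eq (is_deriveX 2 (is_derive_id t 1))).
  by rewrite /GRing.scale/= mulr1 expr1 mulr_natl.
have := is_cderiveZ 2^-1%:C (is_cderive_conj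
  (is_cderive_comp dt (is_cderive_osc_tail h0 h1 w0 t20))).
move/is_cderive_eq; apply; rewrite expiN.
rewrite sqr_powR// (_ : 2 * (1 / 2 - 1) = -1); last by field.
rewrite powR_inv1 ?(ltW t0)// conjcM conjcN conjcM.
rewrite !conjc_real mulrN mulrN; congr (- _); rewrite !mulrA -!real_complexM.
rewrite (_ : 2^-1 * (2 * t) * t^-1 = 1) ?mul1r//.
by field; exact: lt0r_neq0.
Qed.

Lemma ccontinuous_fresnel_tail : ccontinuous_on setT (fresnel_tail w).
Proof.
apply: ccontinuous_onM; first exact: ccontinuous_on_cst.
apply: ccontinuous_on_conj; apply: ccontinuous_on_comp.
  by apply: continuous_subspaceT => t; exact: exprn_continuous.
exact: ccontinuous_osc_tail.
Qed.

Lemma fresnel_tail0 : fresnel_tail w 0 =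
  (2^-1 * (w `^ (- (1 / 2)) * Num.sqrt pi))%:C * expi (- (pi / 4)).
Proof.
rewrite /fresnel_tail (_ : 0 ^+ 2 = 0) ?expr0n// osc_tail0// Gamma_half conjcM
  conjc_real -expiN.
rewrite mulrA -real_complexM; congr (_ * expi _).
by field.
Qed.

(* Up to a common factor and with [p = sqrt w * t], the error is at most
   [1 / p ^ 3] and at most [4 / p], hence at most [2 / p ^ 2]. *)
Lemma fresnel_tail_asymp t : 0 < t ->
  modulus (fresnel_tail w t + 'i%C * expi (- (w * t ^+ 2)) * (2 * w * t)^-1%:C)
  <= 2^-1 * (w `^ (- (3 / 2)) * t `^ (-2)).
Proof.
move=> t0; have t20 : 0 < t ^+ 2 by rewrite exprn_gt0.
have tE : (t ^+ 2) `^ (1 / 2 - 1) = t^-1.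
  by rewrite sqr_powR// -(powR_inv1 (ltW t0)); congr (_ `^ _); field.
set X := osc_tail (1 / 2) w (t ^+ 2) - 'i%C * expi (w * t ^+ 2) * (w^-1 * t^-1)%:C.
rewrite (_ : _ + _ = 2^-1%:C * X^*%C); last first.
  rewrite /fresnel_tail /X conjcB !conjcM !conjc_real expiN conjc_i.
  rewrite (_ : (2 * w * t)^-1 = 2^-1 * (w^-1 * t^-1)); last first.
    by rewrite !invfM; ring.
  by rewrite !real_complexM; ring.
rewrite modulus_half ler_pM2l ?invr_gt0//.
set S := w `^ _ * _; set p := w `^ (1 / 2) * t.
have p0 : 0 < p by rewrite mulr_gt0 ?powR_gt0.
have S0 : 0 < S by rewrite mulr_gt0 ?powR_gt0.
have X1 : modulus X <= S * (2^-1 * p^-1).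
  have := osc_tail_asymp h0 h1 w0 t20; rewrite tE -/X => /le_trans; apply.
  rewrite le_eqVlt; apply/orP; left; apply/eqP.
  rewrite sqr_powR// /S /p invfM -powRN -(powR_inv1 (ltW t0)).
  have -> : w `^ (-2) = w `^ (- (3 / 2)) * w `^ (- (1 / 2)).
    by rewrite -powRD ?lt0r_neq0 ?implybT//; congr (_ `^ _); field.
  have -> : t `^ (2 * (1 / 2 - 2)) = t `^ (-2) * t `^ (-1).
    by rewrite -powRD ?lt0r_neq0 ?implybT//; congr (_ `^ _); field.
  by field.
have X2 : modulus X <= S * (2 * p).
  have Y : modulus ('i%C * expi (w * t ^+ 2) * (w^-1 * t^-1)%:C) = w^-1 * t^-1.
    rewrite modulusM modulusM modulus_i modulus_expi !mul1r.
    by rewrite modulus_real ger0_norm ?mulr_ge0 ?invr_ge0 ?(ltW w0) ?(ltW t0).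
  rewrite (le_trans (modulusB _ _))// Y.
  have := osc_tail_le h0 h1 w0 t20; rewrite tE => H.
  rewrite (le_trans (lerD H (lexx _)))//.
  rewrite le_eqVlt; apply/orP; left; apply/eqP; rewrite /S /p.
  have -> : w^-1 = w `^ (- (3 / 2)) * w `^ (1 / 2).
    rewrite -powRD ?lt0r_neq0 ?implybT// -(powR_inv1 (ltW w0)).
    by congr (_ `^ _); field.
  have -> : t^-1 = t `^ (-2) * t.
    rewrite -[X in _ * X](powRr1 (ltW t0)) -powRD ?lt0r_neq0 ?implybT//.
    by rewrite -(powR_inv1 (ltW t0)); congr (_ `^ _); field.
  by ring.
have [ph|ph] := leP 2^-1 p.
- rewrite (le_trans X1)// ler_piMr ?(ltW S0)//.
  by rewrite ler_pdivrMr// mul1r.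
- rewrite (le_trans X2)// ler_piMr ?(ltW S0)//.
  by rewrite -ler_pdivlMl// mulr1 ltW.
Qed.

(* [gamma = 2 delta - 1], and [1 / sqrt pi <= K] makes [L] the constant in
   [min (sqrt pi) (1 / x) <= sqrt pi (K / x) ^ gamma]. *)
Lemma fresnel_tail_le (delta K t : R) : 1 / 2 < delta < 1 ->
  1 <= Num.sqrt pi * K -> 0 < t ->
  modulus (fresnel_tail w t) <=
  L_constant delta K * w `^ (- delta) * t `^ (- gamma_exponent delta).
Proof.
move=> /andP[d1 d2] K1 t0; rewrite /L_constant /gamma_exponent.
set g := 2 * delta - 1.
have sp0 : 0 < Num.sqrt pi :> R by rewrite sqrtr_gt0 pi_gt0.
have K0 : 0 < K by rewrite -(pmulr_rgt0 _ sp0) (lt_le_trans ltr01).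
have t20 : 0 < t ^+ 2 by rewrite exprn_gt0.
have [g0 g1] : 0 < g /\ g < 1 by split; rewrite /g; lra.
rewrite modulus_half; set x := w `^ (1 / 2) * t.
have x0 : 0 < x by rewrite mulr_gt0 ?powR_gt0.
have B1 : modulus (osc_tail (1 / 2) w (t ^+ 2)) <= w `^ (- (1 / 2)) * Num.sqrt pi.
  by rewrite -Gamma_half; exact: osc_tail_le_Gamma.
have B2 : modulus (osc_tail (1 / 2) w (t ^+ 2)) <= w `^ (- (1 / 2)) * x^-1.
  have := osc_tail_le h0 h1 w0 t20; rewrite sqr_powR// => /le_trans; apply.
  rewrite /x invfM -powRN mulrA -powRD ?lt0r_neq0 ?implybT//.
  rewrite -(powR_inv1 (ltW w0)) -(powR_inv1 (ltW t0)) le_eqVlt.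
  by apply/orP; left; apply/eqP; congr (_ `^ _ * _ `^ _); field.
have -> : Num.sqrt pi / 2 * K `^ g * w `^ (- delta) * t `^ (- g) =
    2^-1 * (w `^ (- (1 / 2)) * (Num.sqrt pi * (K / x) `^ g)).
  rewrite powRM ?(ltW K0) ?invr_ge0 ?(ltW x0)// -(powR_inv1 (ltW x0)) -powRrM.
  rewrite mulN1r powRM ?powR_ge0 ?(ltW t0)// -powRrM.
  have -> : w `^ (- delta) = w `^ (- (1 / 2)) * w `^ (1 / 2 * - g).
    by rewrite -powRD ?lt0r_neq0 ?implybT//; congr (_ `^ _); rewrite /g; field.
  by ring.
rewrite ler_pM2l ?invr_gt0//.
have [xK|Kx] := leP x K.
- rewrite (le_trans B1)// ler_wpM2l ?powR_ge0// ler_peMr ?(ltW sp0)//.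
  have KX : 1 <= K / x by rewrite ler_pdivlMr// mul1r.
  by rewrite -(powRr0 (K / x)) ler_powR// ltW.
- rewrite (le_trans B2)// ler_wpM2l ?powR_ge0//.
  have H : K / x <= (K / x) `^ g.
    rewrite ger1_powR ?(ltW g1)// divr_gt0//= ler_pdivrMr// mul1r; exact: ltW.
  rewrite (le_trans _ (ler_wpM2l (ltW sp0) H))// mulrA ler_peMl//.
  by rewrite invr_ge0 ltW.
Qed.

End Fresnel.

End OscillatoryTail.

(** * Consequences of continuous differentiability on a closed interval *)

Section C1Functions.
Context {R : realType}.
Implicit Types (A : set R) (f g : R -> R) (a b x l : R).

Lemma is_derive_within_interior A f x l : nbhs x A ->
  is_derive_within A f x l -> is_derive x 1 f l.
Proof.
move=> xA fl.
have H : (fun h => h^-1 *: ((f \o shift x) (h *: 1) - f x)) @ 0^' --> l.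
  apply: (@cvg_trans _ ((fun y => (f y - f x) / (y - x)) @ within A x^')) => //.
  have sx : (fun h => h + x) @ (0 : R) --> x.
    rewrite -[X in _ --> X]add0r.
    by apply: cvgD; [exact: cvg_id|exact: cvg_cst].
  move=> P /= HP; rewrite /dnbhs /within /=.
  have {}HP : \forall y \near x, y != x -> A y -> P ((f y - f x) /
    (y - x)) by exact: HP.
  have H1 : \forall h \near (0 : R),
      h + x != x -> A (h + x) -> P ((f (h + x) - f x) /
        (h + x - x)) by exact: sx HP.
  have H2 : \forall h \near (0 : R), A (h + x) by exact: sx xA.
  apply: filterS2 H1 H2 => h H1h Ah h0.
  have hx : h + x != x by rewrite -subr_eq0 addrK.
  by have := H1h hx Ah; rewrite addrK mulrC /= [h *: 1]mulr1.
apply: DeriveDef; first by apply/cvg_ex; exists l.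
exact: (cvg_lim _ H).
Qed.

Lemma is_derive_within_cvg A f x l : A x -> is_derive_within A f x l ->
  f @ within A (nbhs x) --> f x.
Proof.
move=> Ax fl.
have yx : (fun y => y - x) @ within A x^' --> 0.
  have : (fun y => y - x) @ x --> x - x.
    by apply: cvgB; [exact: cvg_id|exact: cvg_cst].
  rewrite subrr => c.
  by apply: cvg_within_filter; exact: cvg_within_filter.
(* Off [x] this expression is [f y], and its limit is [f x + l * 0]. *)
have : (fun y => f x + (f y - f x) / (y - x) *
  (y - x)) @ within A x^' --> f x + l * 0.
  by apply: cvgD; [exact: cvg_cst|exact: cvgM].
rewrite mulr0 addr0 => H P nP.
have {}H : \forall y \near x, y != x -> A y ->
    P (f x + (f y - f x) / (y - x) * (y - x)) by exact: H nP.
rewrite /within /=; apply: filterS H => y Hy Ay.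
have [->|ynx] := eqVneq y x; first exact: nbhs_singleton nP.
by have := Hy ynx Ay; rewrite divfK ?subr_eq0// addrC subrK.
Qed.

Lemma C1_on_within_continuous A f : C1_on A f -> {within A, continuous f}.
Proof.
move=> [g [fg _]]; apply/subspace_continuousP => x Ax.
exact: is_derive_within_cvg (fg x Ax).
Qed.

Lemma C1_on_complex_ccontinuous A (u : R -> R[i]) : C1_on_complex A u ->
  ccontinuous_on A u.
Proof. by move=> [u1 u2]; split; exact: C1_on_within_continuous. Qed.

Lemma C1_on_complex_is_cderive a b (u : R -> R[i]) : C1_on_complex `[a, b] u ->
  exists2 du : R -> R[i], ccontinuous_on `[a, b] du &
    forall x, a < x < b -> is_cderive u x (du x).
Proof.
move=> [[g [ug cg]] [h [uh ch]]]; exists (fun x => g x +i* h x) => //.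
move=> x xab.
have nx : nbhs x `[a, b]%classic.
  apply: filterS (near_in_itvoo (a := a) (b := b) _).
    by move=> y; rewrite /= !in_itv/= => /andP[/ltW -> /ltW ->].
  by rewrite in_itv.
have Ax : `[a, b]%classic x.
  by rewrite /= in_itv/=; case/andP: xab => /ltW -> /ltW ->.
split; apply: is_derive_within_interior nx _; [exact: ug|exact: uh].
Qed.

Lemma ccontinuous_bounded a b
  (u : R -> R[i]) : a <= b -> ccontinuous_on `[a, b] u ->
  exists C, forall x, a <= x <= b -> modulus (u x) <= C.
Proof.
move=> ab [u1 u2].
have c : {within `[a, b], continuous
    (fun t => `|complex.Re (u t)| + `|complex.Im (u t)|)}.
  apply: within_continuousD.
    by apply: within_continuous_comp => //; exact: norm_continuous.
  by apply: within_continuous_comp => //; exact: norm_continuous.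
have [m _ Hm] := EVT_max ab c.
eexists => x xab; rewrite (le_trans (modulus_le_Re_Im _))//.
by apply: Hm; rewrite in_itv.
Qed.

Lemma ccontinuous_modulus A (u : R -> R[i]) : ccontinuous_on A u ->
  {within A, continuous (fun t => modulus (u t))}.
Proof.
move=> [u1 u2].
have E t : modulus (u t) = Num.sqrt (complex.Re (u t) * complex.Re (u t) +
    complex.Im (u t) * complex.Im (u t)).
  by rewrite -!expr2; case: (u t).
under eq_fun do rewrite E.
apply: (within_continuous_comp (g := @Num.sqrt R)); last exact: sqrt_continuous.
by apply: within_continuousD; exact: within_continuousM.
Qed.

(** [K_mu] contains the value of the amplitude at [p1], while the sup norm only controls the open
    interval; continuity transfers the bound. *)
Lemma modulus_le_left_end a b (u : R -> R[i]) (C : R) : a < b ->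
  ccontinuous_on `[a, b] u -> (forall x, a < x < b -> modulus (u x) <= C) ->
  modulus (u a) <= C.
Proof.
move=> ab /ccontinuous_modulus /(continuous_within_itvP _ ab)[_ ua _] uC.
apply: cvgr_to_le ua _; near=> x.
by apply: uC; apply/andP; split; near: x;
  [exact: nbhs_right_gt|exact: nbhs_right_lt].
Unshelve. all: end_near. Qed.

End C1Functions.

(** * Pointwise control by the essential supremum *)

Section SupNorm.
Context {R : realType}.
Local Notation leb := (@lebesgue_measure R).
Variables (a b : R) (u : R -> R[i]).
Hypothesis ab : a < b.
Local Notation nu := (mrestr leb (measurable_itv `]a, b[)).

(** If [|u x|] exceeded the essential supremum, continuity would make it do so on a whole interval
    around [x], which would have positive length inside a null set. The bound [C] makes the
    essential supremum finite; otherwise [fine] would replace it by 0. *)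
Lemma modulus_le_Linfty_norm (C : R) :
  ccontinuous_on `]a, b[ u -> (forall x, a < x < b -> modulus (u x) <= C) ->
  forall x, a < x < b -> modulus (u x) <= Linfty_norm a b u.
Proof.
move=> cu uC x xab.
have nu0 : (0 < nu setT)%E.
  by rewrite /mrestr setTI lebesgue_measure_itv/= lte_fin ab -EFinD lte_fin
    subr_gt0.
have aeC : {ae nu, forall x, ((abse \o (fun x => (modulus (u x))%:E)) x <= C%:E)%E}.
  exists (~` `]a, b[); split => /=.
  - exact: measurableC.
  - by rewrite /mrestr setICl measure0.
  - move=> y; apply: contra_not => yab; rewrite /= lee_fin ger0_norm ?modulus_ge0//.
    by apply: uC; move: yab; rewrite /= in_itv.
rewrite /Linfty_norm unlock nu0.
set E := ess_sup _ _.
have EC : (E <= C%:E)%E by apply/ess_supP.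
have E0 : (0 <= E)%E.
  by apply: ess_sup_gee => //; apply: aeW => y; rewrite /= lee_fin normr_ge0.
have Efin : E \is a fin_num by rewrite ge0_fin_numE// (le_lt_trans EC) ?ltry.
have aeE : {ae nu, forall x, ((abse \o (fun x => (modulus (u x))%:E)) x <= E)%E}.
  exact: ess_sup_ge.
rewrite leNgt; apply/negP => Eu.
have cx : {for x, continuous (fun t => modulus (u t))}.
  have := ccontinuous_modulus cu; rewrite continuous_open_subspace;
    last exact: interval_open.
  by apply; rewrite inE/= in_itv.
have : \forall y \near x, fine E < modulus (u y) /\ y \in `]a, b[.
  near=> y; split.
    by near: y; apply: cvgr_gt Eu; exact: cx.
  by near: y; apply: near_in_itvoo; rewrite in_itv.
move=> /nbhs_ballP[r /= r0 Hr].
have [N [mN N0 HN]] := aeE.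
have sub : `]x - r, x + r[%classic `<=` N `&` `]a, b[.
  rewrite -ball_itv => y /Hr[Ey yab]; split => //.
  apply: HN => /=; apply/negP; rewrite -ltNge -(fineK Efin) lte_fin ger0_norm//.
  exact: modulus_ge0.
have : (leb `](x - r)%R, (x + r)%R[ <= leb (N `&` `]a, b[))%E.
  apply: le_measure => //; rewrite inE//.
  exact: measurableI.
rewrite [X in (_ <= X)%E]N0 lebesgue_measure_itv/= lte_fin.
have -> : x - r < x + r by lra.
rewrite -EFinD lee_fin => ?; lra.
Unshelve. all: end_near. Qed.

End SupNorm.

(** * Primitives of complex functions integrable up to a singular left endpoint *)

Section Primitive.
Context {R : realType}.
Local Notation leb := (@lebesgue_measure R).
Variables (a b : R) (u : R -> R[i]).
Hypotheses (ab : a < b) (ui : cintegrable `]a, b] u).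

Lemma integrable_itv_obnd_cbnd (f : R -> R) :
  leb.-integrable `]a, b] (EFin \o f) -> leb.-integrable `[a, b] (EFin \o f).
Proof.
move=> /integrableP[mf fi]; apply/integrableP; split.
  apply/measurable_EFinP; apply/measurable_fun_itv_obnd_cbndP.
  exact/measurable_EFinP.
by rewrite -integral_itv_obnd_cbnd//; apply: measurableT_comp.
Qed.

Let primitive_continuous (f : R -> R) : leb.-integrable `]a, b] (EFin \o f) ->
  {within `[a, b], continuous (fun x => \int[leb]_(t in `]a, x]) f t)}.
Proof.
move=> fi; have := parameterized_integral_continuous (ltW ab)
  (integrable_itv_obnd_cbnd fi).
apply: within_continuous_eq => x /[1!inE]/=; rewrite in_itv/= => /andP[ax xb].
rewrite /parameterized_integral -Rintegral_itv_obnd_cbnd//.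
by apply: integrableS fi => //; apply: subset_itvl; rewrite bnd_simp.
Qed.

Let primitive_derive (f : R -> R) x : leb.-integrable `]a, b] (EFin \o f) ->
  a < x < b -> {for x, continuous f} ->
  is_derive x 1 (fun x => \int[leb]_(t in `]a, x]) f t) (f x).
Proof.
move=> fi /andP[ax xb] cf.
have [] := @continuous_FTC1 R f (BRight a) x b xb fi _ cf; first by [].
move=> d1 d2; apply: DeriveDef; first exact: d1.
by rewrite -derive1E; exact: d2.
Qed.

Definition primitive x := Cintegral `]a, x] u.

Lemma ccontinuous_primitive : ccontinuous_on `[a, b] primitive.
Proof. by case: ui => u1 u2; split; exact: primitive_continuous. Qed.

Lemma is_cderive_primitive x : ccontinuous_on `]a, b[ u -> a < x < b ->
  is_cderive primitive x (u x).
Proof.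
move=> [c1 c2] xab; case: ui => u1 u2.
move: c1 c2; rewrite !continuous_open_subspace; try exact: interval_open.
move=> c1 c2; have xI : x \in `]a, b[%classic by rewrite inE/= in_itv.
by split; apply: primitive_derive => //; [exact: c1|exact: c2].
Qed.

Lemma primitive_left : primitive a = 0.
Proof.
by rewrite /primitive /Cintegral set_itvoc0// !Rintegral_set0.
Qed.

End Primitive.

(** * Expansion of the integral on the three pieces, for arbitrary [h] and [w] *)

Section StationaryPhase.
Context {R : realType}.
Local Notation leb := (@lebesgue_measure R).
Variables (p1 p2 mu h w c delta K M0 M : R) (ut dut : R -> R[i]).
Hypotheses (mu0 : 0 < mu) (mu1 : mu < 1).
Hypotheses (h0 : 0 < h) (hp : p1 + h < p2) (w0 : 0 < w).
Hypotheses (delta_bd : 1 / 2 < delta < 1) (sqrtpiK : 1 <= Num.sqrt pi * K).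
Hypothesis cut : ccontinuous_on `[p1, p2] ut.
Hypothesis dutP : forall x, p1 < x < p2 -> is_cderive ut x (dut x).
Hypothesis ut_le : forall x, p1 < x < p2 -> modulus (ut x) <= M0.
Hypothesis dut_le : forall x, p1 < x < p2 -> modulus (dut x) <= M.
Hypothesis M0M : M0 <= M.

Local Notation p0 := (p1 + h).
Local Notation q := (p1 + h / 2).
Local Notation gamma := (gamma_exponent delta).
Local Notation L := (L_constant delta K).

Definition amplitude x : R[i] := ((x - p1) `^ (mu - 1))%:C * ut x.

Definition oscillation x : R[i] := expi (w * (- (x - p0) ^+ 2 + c)).

Definition singular_integral x : R[i] :=
  primitive p1 (fun y => amplitude y * oscillation y) x.

Definition amplitude_derivative x : R[i] :=
  ((mu - 1) * (x - p1) `^ (mu - 2))%:C * ut x + ((x - p1) `^ (mu - 1))%:C * dut x.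

Local Notation J := singular_integral.
Local Notation A := amplitude.
Local Notation dA := amplitude_derivative.
Local Notation e := (expi (w * c)).

Let p12 : p1 < p2. Proof. by apply: lt_trans hp; rewrite ltrDl. Qed.

Let M0_ge0 : 0 <= M0.
Proof.
apply: le_trans (modulus_ge0 _) (ut_le (x := p0) _).
by rewrite hp ltrDl h0.
Qed.

Let M_ge0 : 0 <= M. Proof. exact: le_trans M0M. Qed.

Let is_derive_shift_powR b x : p1 < x ->
  is_derive x 1 (fun t => (t - p1) `^ b) (b * (x - p1) `^ (b - 1)).
Proof.
move=> px; have xp : 0 < x - p1 by rewrite subr_gt0.
apply: (is_derive_eq (is_derive_powR_comp (f := fun t => t - p1) b xp
  (is_derive_subr p1 x))).
by rewrite mulr1.
Qed.

Lemma is_cderive_amplitude x : p1 < x < p2 -> is_cderive A x (dA x).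
Proof.
move=> /[dup] xp /andP[px _].
have := is_cderiveM (is_cderive_real (is_derive_shift_powR (mu - 1) px)) (dutP xp).
by move/is_cderive_eq; apply; rewrite /dA (_ : mu - 1 - 1 = mu - 2)//; lra.
Qed.

(** Both powers have negative exponents, so a lower bound [s] on the distance to the singularity
    suffices: [h] on [[p0, p2]] and [h / 2] on [[q, p0]]. *)
Lemma amplitude_derivative_le x s : 0 < s -> s <= x - p1 -> x < p2 ->
  modulus (dA x) <= (1 - mu) * s `^ (mu - 2) * M + s `^ (mu - 1) * M.
Proof.
move=> s0 sx xp; have xp0 := lt_le_trans s0 sx.
have xp12 : p1 < x < p2 by rewrite xp -subr_gt0 xp0.
rewrite (le_trans (modulusD _ _))// lerD//.
- rewrite modulusM modulus_real normrM [`|_ `^ _|]ger0_norm ?powR_ge0//.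
  rewrite ler0_norm ?subr_le0 ?(ltW mu1)// opprB ler_pM//.
  + by rewrite mulr_ge0 ?powR_ge0// subr_ge0 ltW.
  + exact: modulus_ge0.
  + rewrite ler_wpM2l ?subr_ge0 ?(ltW mu1)// le0_ler_powR ?posrE//.
    by move: mu1; lra.
  + exact: le_trans (ut_le xp12) M0M.
- rewrite modulusM modulus_real ger0_norm ?powR_ge0// ler_pM ?powR_ge0
    ?modulus_ge0//.
    by rewrite le0_ler_powR ?posrE//; move: mu1; lra.
  exact: dut_le.
Qed.

Lemma ccontinuous_amplitude x : p1 < x -> ccontinuous_on `[x, p2] A.
Proof.
move=> px; apply: ccontinuous_onM; last first.
  by apply: ccontinuous_on_subset cut; apply: subset_itvr; rewrite bnd_simp ltW.
apply: ccontinuous_on_real; apply: derivable_within_continuous => y.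
rewrite in_itv/= => /andP[xy _].
by have := is_derive_shift_powR (mu - 1) (lt_le_trans px xy) => ?; exact: ex_derive.
Qed.

Let ccontinuous_oscillation (B : set R) : ccontinuous_on B oscillation.
Proof.
apply: (ccontinuous_on_comp (f := fun x => w * (- (x - p0) ^+ 2 + c)));
  last exact: ccontinuous_expi.
apply: continuous_subspaceT => x; apply: cvgM; first exact: cvg_cst.
apply: cvgD; last exact: cvg_cst.
apply: cvgN; rewrite [X in _ --> X]expr2; under eq_fun do rewrite expr2.
by apply: cvgM; apply: cvgB;
  [exact: cvg_id|exact: cvg_cst|exact: cvg_id|exact: cvg_cst].
Qed.

Lemma cintegrable_integrand :
  cintegrable `]p1, p2] (fun y => amplitude y * oscillation y).
Proof.
have [C HC] := ccontinuous_bounded (ltW p12) cut.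
have mu1' : -1 < mu - 1 by move: mu0; lra.
have i1 : leb.-integrable `]p1, p2] (EFin \o (fun x => C * (x - p1) `^ (mu - 1))).
  have : leb.-integrable `]p1, p2] (fun x => C%:E * ((x - p1) `^ (mu - 1))%:E)%E.
    by apply: integrableZl => //; exact: (integrable_powR_oc p12 mu1').
  exact.
apply: cintegrable_le i1 _ => //; last first.
  move=> x /=; rewrite in_itv/= => /andP[px xp].
  rewrite modulusM modulus_expi mulr1 modulusM modulus_real ger0_norm ?powR_ge0//.
  by rewrite mulrC ler_wpM2r ?powR_ge0// HC// (ltW px).
apply: cmeasurableM; last by apply: ccontinuous_cmeasurable.
apply: cmeasurableM; last first.
  apply: ccontinuous_cmeasurable => //; apply: ccontinuous_on_subset cut.
  by apply: subset_itvr; rewrite bnd_simp.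
apply: cmeasurable_real.
by have /integrableP[/measurable_EFinP] := integrable_powR_oc p12 mu1'.
Qed.

Lemma is_cderive_singular_integral x : p1 < x < p2 ->
  is_cderive J x (A x * oscillation x).
Proof.
move=> xp; have := is_cderive_primitive cintegrable_integrand _ xp; apply.
apply: ccontinuous_onM; last exact: ccontinuous_oscillation.
by apply: is_cderive_ccontinuous => y; rewrite in_itv/=;
  exact: is_cderive_amplitude.
Qed.

Lemma ccontinuous_singular_integral x : p1 <= x -> ccontinuous_on `[x, p2] J.
Proof.
move=> px; apply: ccontinuous_on_subset
  (ccontinuous_primitive p12 cintegrable_integrand).
by apply: subset_itvr; rewrite bnd_simp.
Qed.

Let oscillationE x : oscillation x = e * expi (- (w * (x - p0) ^+ 2)).
Proof. by rewrite /oscillation -expiD; congr expi; ring. Qed.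

Let gamma1 : 0 < 1 - gamma.
Proof. by rewrite /gamma_exponent; case/andP: delta_bd => *; lra. Qed.

Let is_cderive_fresnel_shift x (f : R -> R)
  (df : R) : 0 < f x -> is_derive x 1 f df ->
  is_cderive (fun t => fresnel_tail w (f t)) x (df%:C * - expi (- (w * f x ^+ 2))).
Proof. by move=> fx fd; exact: is_cderive_comp fd
  (is_cderive_fresnel_tail w0 fx). Qed.

Let L_ge0 : 0 <= L.
Proof. by rewrite /L_constant mulr_ge0 ?powR_ge0// divr_ge0// sqrtr_ge0. Qed.

(** The tail has derivative [- expi (- w (x - p0) ^ 2)], which cancels the integrand; what remains
    is [e * dA * fresnel_tail], bounded by a constant times [(x - p0) ^ (- gamma)]. *)
Lemma right_piece :
  modulus (J p2 + e * (A p2 * fresnel_tail w (p2 - p0))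
         - (J p0 + e * (A p0 * fresnel_tail w 0))) <=
  ((1 - mu) * h `^ (mu - 2) * M + h `^ (mu - 1) * M) * (L * w `^ (- delta)) *
  ((p2 - p0) `^ (1 - gamma) / (1 - gamma)).
Proof.
set C := _ * (L * _).
pose D x := J x + e * (A x * fresnel_tail w (x - p0)).
have -> : J p0 + e * (A p0 * fresnel_tail w 0) = D p0 by rewrite /D subrr.
(* A primitive of that bound, finite at [p0] because [gamma < 1]. *)
pose g x := C * ((x - p0) `^ (1 - gamma) / (1 - gamma)).
have -> : C * ((p2 - p0) `^ (1 - gamma) / (1 - gamma)) = g p2 - g p0.
  by rewrite /g subrr powR0 ?mul0r ?mulr0 ?subr0// gt_eqF.
have cx : continuous (fun x => x - p0).
  by move=> x; apply: cvgB; [exact: cvg_id|exact: cvg_cst].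
apply: (@modulus_mean_value _ D (fun x => e * (dA x * fresnel_tail w (x - p0))) g
  (fun x => C * (x - p0) `^ (- gamma))).
- exact: ltW.
- apply: ccontinuous_onD.
    by apply: ccontinuous_singular_integral; rewrite lerDl ltW.
  apply: ccontinuous_onM; first exact: ccontinuous_on_cst.
  apply: ccontinuous_onM; first by apply: ccontinuous_amplitude; rewrite ltrDl.
  apply: ccontinuous_on_comp; last exact: ccontinuous_fresnel_tail.
  exact: continuous_subspaceT.
- apply: within_continuousM; first exact: within_continuous_cst.
  apply: within_continuousM; last exact: within_continuous_cst.
  apply: within_continuous_powR => //; first exact: continuous_subspaceT.
  by move=> x /=; rewrite in_itv/= subr_ge0 => /andP[].
- move=> x /andP[px xp].
  have p1x : p1 < x by rewrite (lt_trans _ px)// ltrDl.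
  have xp12 : p1 < x < p2 by rewrite p1x.
  have xp0 : 0 < x - p0 by rewrite subr_gt0.
  have d1 := is_cderive_fresnel_shift (f := fun t => t - p0) xp0
    (is_derive_subr p0 x).
  have d2 := is_cderiveD (is_cderive_singular_integral xp12)
    (is_cderiveZ e (is_cderiveM (is_cderive_amplitude xp12) d1)).
  apply: (is_cderive_eq d2); rewrite oscillationE.
  by ring.
- move=> x /andP[px _]; have xp0 : 0 < x - p0 by rewrite subr_gt0.
  have d1 := is_derive_powR_comp (f := fun t => t - p0) (1 - gamma) xp0
    (is_derive_subr p0 x).
  have := is_deriveZ C (is_deriveM d1 (is_derive_cst (1 - gamma)^-1 x 1)).
  move/is_derive_eq; apply; rewrite scaler0 add0r /GRing.scale/=.
  rewrite mulr1 addrAC subrr add0r; congr (_ * _); rewrite mulKf//;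
    exact: lt0r_neq0.
- move=> x /andP[px xp]; have xp0 : 0 < x - p0 by rewrite subr_gt0.
  rewrite modulusM modulus_expi mul1r modulusM /C -[leRHS]mulrA ler_pM
    ?modulus_ge0//.
    by apply: amplitude_derivative_le => //; rewrite lerBrDl (ltW px).
  exact: fresnel_tail_le.
Qed.

(** Mirror image of [right_piece]: the tail is taken at [p0 - x], which reverses the sign of its
    derivative and hence of the correction. The two corrections at [p0] therefore add up, to the
    full Fresnel integral. *)
Lemma middle_piece :
  modulus (J p0 - e * (A p0 * fresnel_tail w 0)
         - (J q - e * (A q * fresnel_tail w (h / 2)))) <=
  ((1 - mu) * (h / 2) `^ (mu - 2) * M + (h / 2) `^ (mu - 1) * M) *
  (L * w `^ (- delta)) * ((h / 2) `^ (1 - gamma) / (1 - gamma)).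
Proof.
set C := _ * (L * _).
have h20 : 0 < h / 2 by rewrite divr_gt0.
have qp0 : q < p0 by rewrite ltrD2l ltr_pdivrMr// ltr_pMr// ltr1n.
have p0q : p0 - q = h / 2 by field.
pose D x := J x + - e * (A x * fresnel_tail w (p0 - x)).
have -> : J p0 - e * (A p0 * fresnel_tail w 0) = D p0 by rewrite /D subrr mulNr.
have -> : J q - e * (A q * fresnel_tail w (h / 2)) = D q by rewrite /D p0q mulNr.
pose g x := - C * ((p0 - x) `^ (1 - gamma) / (1 - gamma)).
have -> : C * ((h / 2) `^ (1 - gamma) / (1 - gamma)) = g p0 - g q.
  by rewrite /g subrr powR0 ?gt_eqF// p0q mul0r mulr0 sub0r mulNr opprK.
have cx : continuous (fun x => p0 - x).
  by move=> x; apply: cvgB; [exact: cvg_cst|exact: cvg_id].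
apply: (@modulus_mean_value _ D (fun x => - e * (dA x * fresnel_tail w (p0 - x))) g
  (fun x => C * (p0 - x) `^ (- gamma))).
- exact: ltW.
- apply: ccontinuous_onD.
    apply: (ccontinuous_on_subset (B := `[q, p2])).
      by apply: subset_itvl; rewrite bnd_simp ltW.
    by apply: ccontinuous_singular_integral; rewrite lerDl ltW.
  apply: ccontinuous_onM; first exact: ccontinuous_on_cst.
  apply: ccontinuous_onM.
    apply: (ccontinuous_on_subset (B := `[q, p2])).
      by apply: subset_itvl; rewrite bnd_simp ltW.
    by apply: ccontinuous_amplitude; rewrite ltrDl.
  apply: ccontinuous_on_comp; last exact: ccontinuous_fresnel_tail.
  exact: continuous_subspaceT.
- apply: within_continuousM; first exact: within_continuous_cst.
  apply: within_continuousM; last exact: within_continuous_cst.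
  apply: within_continuous_powR => //; first exact: continuous_subspaceT.
  by move=> x /=; rewrite in_itv/= subr_ge0 => /andP[].
- move=> x /andP[qx xp].
  have p1x : p1 < x by rewrite (lt_trans _ qx)// ltrDl.
  have xp12 : p1 < x < p2 by rewrite p1x (lt_trans xp).
  have xp0 : 0 < p0 - x by rewrite subr_gt0.
  have d1 := is_cderive_fresnel_shift (f := fun t => p0 - t) xp0
    (is_derive_subl p0 x).
  have d2 := is_cderiveD (is_cderive_singular_integral xp12)
    (is_cderiveZ (- e) (is_cderiveM (is_cderive_amplitude xp12) d1)).
  apply: (is_cderive_eq d2);
    rewrite oscillationE -[p0 - x]opprB sqrrN real_complexN.
  by ring.
- move=> x /andP[_ xp]; have xp0 : 0 < p0 - x by rewrite subr_gt0.
  have d1 := is_derive_powR_comp (f := fun t => p0 - t) (1 - gamma) xp0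
    (is_derive_subl p0 x).
  have := is_deriveZ (- C) (is_deriveM d1 (is_derive_cst (1 - gamma)^-1 x 1)).
  move/is_derive_eq; apply; rewrite scaler0 add0r /GRing.scale/=.
  rewrite (_ : 1 - gamma - 1 = - gamma); last by ring.
  by field; exact: lt0r_neq0.
- move=> x /andP[qx xp]; have xp0 : 0 < p0 - x by rewrite subr_gt0.
  rewrite modulusM modulusN modulus_expi mul1r modulusM /C -[leRHS]mulrA.
  rewrite ler_pM ?modulus_ge0//; last exact: fresnel_tail_le.
  apply: amplitude_derivative_le => //; first by rewrite lerBrDl (ltW qx).
  exact: lt_trans hp.
Qed.

(* On [[p1, q]] the phase is [v = s (2 h - s)] up to a constant, with
   [s = x - p1], and [v' = 2 (h - s)]; [chirp] is [s ^ (mu - 1)] divided by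
   [v ^ (mu - 1) v']. *)
Local Notation v x := ((x - p1) * (2 * h - (x - p1))).

Definition chirp x : R := (2 * h - (x - p1)) `^ (1 - mu) * (2 * (h - (x - p1)))^-1.

(** Kept as [chirp] times its logarithmic derivative: on [[p1, q]] the second factor lies between 0
    and [2 / h], which is how [left_piece] bounds it. *)
Definition chirp_derivative x : R :=
  chirp x * ((h - (x - p1))^-1 - (1 - mu) / (2 * h - (x - p1))).

Local Notation e1 := (expi (w * (- h ^+ 2 + c))).

Let is_derive_chirp x : x - p1 < h -> is_derive x 1 chirp (chirp_derivative x).
Proof.
move=> xh; have xh0 : 0 < h - (x - p1) by rewrite subr_gt0.
have x2h0 : 0 < 2 * h - (x - p1) by move: h0; lra.
have d2 : is_derive x 1 (fun t => 2 * h - (t - p1)) (- 1).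
  apply: (is_derive_eq (is_deriveB (is_derive_cst (2 * h) x 1)
    (is_derive_subr p1 x))).
  by rewrite sub0r.
have d1 : is_derive x 1 (fun t => 2 * (h - (t - p1))) (- 2).
  apply: (is_derive_eq (is_deriveZ 2 (is_deriveB (is_derive_cst h x 1)
    (is_derive_subr p1 x)))).
  by rewrite sub0r /GRing.scale/= mulrN1.
have nz : 2 * (h - (x - p1)) != 0 by rewrite lt0r_neq0// mulr_gt0.
have d3 := is_derive_powR_comp (f := fun t => 2 * h - (t - p1)) (1 - mu) x2h0 d2.
have d4 := is_deriveV (f := fun t => 2 * (h - (t - p1))) nz d1.
apply: (is_derive_eq (is_deriveM d3 d4)).
rewrite /GRing.scale/= /chirp_derivative /chirp [_ `^
  (1 - mu - 1)]powRB ?lt0r_neq0 ?implybT//.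
rewrite powRr1 ?ltW//.
by field; rewrite !lt0r_neq0.
Qed.

Let chirpE x : p1 < x -> x - p1 < h ->
  chirp x * v x `^ (mu - 1) = (x - p1) `^ (mu - 1) / (2 * (h - (x - p1))).
Proof.
move=> px xh; have xp0 : 0 < x - p1 by rewrite subr_gt0.
have x2h0 : 0 < 2 * h - (x - p1) by move: h0; lra.
have E : (2 * h - (x - p1)) `^ (1 - mu) * (2 * h - (x - p1)) `^ (mu - 1) = 1.
  by rewrite -powRD ?lt0r_neq0 ?implybT// (_ : 1 - mu + _ = 0) ?powRr0//; ring.
by rewrite /chirp powRM ?ltW// [X in _ * X]mulrC mulrACA E mul1r mulrC.
Qed.

(** Since [(x - p0) ^ 2 = h ^ 2 - v x], the oscillation is [e1 * expi (w * v x)], and [chirp] is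
    chosen so that the derivative of the tail cancels the integrand. In the rest, the tail costs
    [v ^ (mu - 1) / w]; times [chirp] this is at most [(x - p1) ^ (mu - 1) / (w h)]. Unlike the
    derivative of the amplitude, this is integrable at [p1]. *)
Lemma left_piece :
  modulus (J q + e1 * ((chirp q)%:C * ut q * osc_tail mu w (v q))
         - (J p1 + e1 * ((chirp p1)%:C * ut p1 * osc_tail mu w (v p1)))) <=
  (2 / h * M + M) * (w^-1 / h) * ((h / 2) `^ mu / mu).
Proof.
set C := _ * (w^-1 / h).
have h20 : 0 < h / 2 by rewrite divr_gt0.
have qp0 : q < p0 by rewrite ltrD2l ltr_pdivrMr// ltr_pMr// ltr1n.
have p1q : p1 < q by rewrite ltrDl.
pose D x := J x + e1 * ((chirp x)%:C * ut x * osc_tail mu w (v x)).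
pose g x := C * ((x - p1) `^ mu / mu).
have -> : C * ((h / 2) `^ mu / mu) = g q - g p1.
  by rewrite /g subrr powR0 ?gt_eqF// mul0r mulr0 subr0 [q - p1]addrAC subrr add0r.
pose dD x := e1 * (((chirp_derivative x)%:C * ut x + (chirp x)%:C * dut x) *
  osc_tail mu w (v x)).
have xh x : x < q -> x - p1 < h / 2 by rewrite ltrBlDl.
have hh : h / 2 < h by rewrite ltr_pdivrMr// ltr_pMr// ltr1n.
apply: (@modulus_mean_value _ D dD g (fun x => C * (x - p1) `^ (mu - 1))).
- exact: ltW.
- have sub : `[p1, q]%classic `<=` `[p1, p2]%classic.
    by apply: subset_itvl; rewrite bnd_simp ltW// (lt_trans qp0).
  apply: ccontinuous_onD.
    apply: ccontinuous_on_subset sub _; exact: ccontinuous_singular_integral.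
  apply: ccontinuous_onM; first exact: ccontinuous_on_cst.
  apply: ccontinuous_onM.
    apply: ccontinuous_onM; last exact: ccontinuous_on_subset sub cut.
    apply: ccontinuous_on_real; apply: derivable_within_continuous => x.
    rewrite in_itv/= => /andP[_ xq].
    have xph : x - p1 < h by rewrite ltrBlDl (le_lt_trans xq).
    by have := is_derive_chirp xph => ?; exact: ex_derive.
  apply: (ccontinuous_on_comp (u := osc_tail mu w) (f := fun x => v x)); last first.
    by apply: ccontinuous_osc_tail => //; exact: ltW.
  apply: continuous_subspaceT => x; apply: cvgM.
    by apply: cvgB; [exact: cvg_id|exact: cvg_cst].
  apply: cvgB; first exact: cvg_cst.
  by apply: cvgB; [exact: cvg_id|exact: cvg_cst].
- apply: within_continuousM; first exact: within_continuous_cst.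
  apply: within_continuousM; last exact: within_continuous_cst.
  apply: within_continuous_powR => //.
    by apply: continuous_subspaceT => x; apply: cvgB;
      [exact: cvg_id|exact: cvg_cst].
  by move=> x /=; rewrite in_itv/= subr_ge0 => /andP[].
- move=> x /andP[px xq].
  have xph : x - p1 < h by rewrite (lt_trans (xh _ xq)).
  have xp12 : p1 < x < p2 by rewrite px (lt_trans xq)// (lt_trans qp0).
  have xp0 : 0 < x - p1 by rewrite subr_gt0.
  have hx0 : 0 < h - (x - p1) by rewrite subr_gt0.
  have x2h0 : 0 < 2 * h - (x - p1) by move: h0; lra.
  have v0 : 0 < v x by rewrite mulr_gt0.
  have dv : is_derive x 1 (fun t => v t) (2 * (h - (x - p1))).
    have d2 := is_deriveB (is_derive_cst (2 * h) x 1) (is_derive_subr p1 x).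
    apply: (is_derive_eq (is_deriveM (is_derive_subr p1 x) d2)).
    by rewrite /GRing.scale/= !fctE; ring.
  have dG := is_cderive_comp (u := osc_tail mu w) dv
    (is_cderive_osc_tail mu0 (ltW mu1) w0 v0).
  have dk := is_cderiveM (is_cderive_real (is_derive_chirp xph)) (dutP xp12).
  have d := is_cderiveD (is_cderive_singular_integral xp12) (is_cderiveZ e1
    (is_cderiveM dk dG)).
  apply: (is_cderive_eq d); rewrite /dD /A.
  have -> : (x - p1) `^ (mu - 1) = chirp x * (2 * (h - (x - p1))) * v x `^ (mu - 1).
    by rewrite mulrAC chirpE//; field; exact: lt0r_neq0.
  have -> : oscillation x = e1 * expi (w * v x).
    by rewrite /oscillation -expiD; congr expi; ring.
  by rewrite !real_complexM; ring.
- move=> x /andP[px xq].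
  have d1 := is_derive_shift_powR mu px.
  have := is_deriveZ C (is_deriveM d1 (is_derive_cst mu^-1 x 1)).
  move/is_derive_eq; apply; rewrite scaler0 add0r /GRing.scale/=.
  by field; exact: lt0r_neq0.
- move=> x /andP[px xq].
  have xph : x - p1 < h by rewrite (lt_trans (xh _ xq)).
  have xp12 : p1 < x < p2 by rewrite px (lt_trans xq)// (lt_trans qp0).
  have xp0 : 0 < x - p1 by rewrite subr_gt0.
  have hx0 : 0 < h - (x - p1) by rewrite subr_gt0.
  have x2h0 : 0 < 2 * h - (x - p1) by move: h0; lra.
  have v0 : 0 < v x by rewrite mulr_gt0.
  have k0 : 0 <= chirp x by rewrite mulr_ge0 ?powR_ge0// invr_ge0 mulr_ge0// ltW.
  (* Here the midpoint is used: left of [q] the derivative of the phase is at least [h]. *)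
  have hx : h / 2 <= h - (x - p1) by have := xh _ xq; lra.
  have ih : (h - (x - p1))^-1 <= 2 / h.
    by rewrite -[2 / h]invf_div lef_pV2.
  have B : modulus ((chirp_derivative x)%:C * ut x + (chirp x)%:C * dut x) <=
      (2 / h * M + M) * chirp x.
    rewrite (le_trans (modulusD _ _))// mulrDl lerD//.
    - rewrite modulusM modulus_real mulrAC ler_pM ?modulus_ge0//; last first.
        exact: le_trans (ut_le xp12) M0M.
      rewrite /chirp_derivative normrM (ger0_norm k0) mulrC ler_wpM2r//.
      rewrite ger0_norm; last first.
        (* With [s = x - p1], the claim is [(1 - mu) (h - s) <= 2 h - s]; the difference of the two
           sides is [h + mu (h - s)]. *)
        rewrite subr_ge0 ler_pdivrMr// mulrC ler_pdivlMr//.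
        have : 0 <= mu * (h - (x - p1)) by rewrite mulr_ge0// ltW.
        by move: h0 xp0; lra.
      rewrite (le_trans _ ih)// lerBlDr lerDl mulr_ge0 ?invr_ge0 ?(ltW x2h0)//.
      by rewrite subr_ge0 ltW.
    - rewrite modulusM modulus_real (ger0_norm k0) mulrC ler_wpM2r//.
      exact: dut_le.
  rewrite /dD modulusM modulus_expi mul1r modulusM.
  rewrite (le_trans (ler_pM (modulus_ge0 _) (modulus_ge0 _) B
    (osc_tail_le mu0 (ltW mu1) w0 v0)))//.
  rewrite /C -[leLHS]mulrA -[leRHS]mulrA ler_wpM2l//.
    by rewrite addr_ge0// !mulr_ge0// invr_ge0 ltW.
  rewrite [leLHS]mulrCA -[leRHS]mulrA ler_wpM2l ?invr_ge0 ?(ltW w0)//.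
  rewrite chirpE// [leLHS]mulrC ler_wpM2r ?powR_ge0//.
  by rewrite lef_pV2 ?posrE ?mulr_gt0//; lra.
Qed.

(* The leading parts of the two boundary terms at [q] cancel. *)
Lemma boundary_terms :
  modulus (e * (A q * fresnel_tail w (h / 2)) +
           e1 * ((chirp q)%:C * ut q * osc_tail mu w (v q))) <=
  (h / 2) `^ (mu - 1) * M0 * (2^-1 * (w `^ (- (3 / 2)) * (h / 2) `^ (-2))) +
  (h / 2) `^ (mu - 1) / h * M0 * ((1 - mu) * (w `^ (-2) * (3 / 4 * h ^+ 2)^-1)).
Proof.
have h20 : 0 < h / 2 by rewrite divr_gt0.
have qp1 : q - p1 = h / 2 by rewrite addrAC subrr add0r.
have p1q : p1 < q by rewrite ltrDl.
have qh : q - p1 < h by rewrite qp1 ltr_pdivrMr// ltr_pMr// ltr1n.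
have qp12 : p1 < q < p2.
  by rewrite p1q (lt_trans _ hp)// ltrD2l -qp1.
have vq : v q = 3 / 4 * h ^+ 2 by rewrite qp1; field.
have v0 : 0 < v q by rewrite vq mulr_gt0// exprn_gt0.
have kv : chirp q * v q `^ (mu - 1) = (h / 2) `^ (mu - 1) / h.
  by rewrite chirpE// qp1; congr (_ / _); field.
have uq := ut_le qp12.
set X := fresnel_tail w (h / 2) + 'i%C * expi (- (w * (h / 2) ^+ 2)) *
  (2 * w * (h / 2))^-1%:C.
set Y := osc_tail mu w (v q) - 'i%C * expi (w * v q) * (w^-1 * v q `^ (mu - 1))%:C.
have -> : e * (A q * fresnel_tail w (h / 2)) +
           e1 * ((chirp q)%:C * ut q * osc_tail mu w (v q)) =
          e * (A q * X) + e1 * ((chirp q)%:C * ut q * Y).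
  (* Both sides carry the phase of the integrand at [q], namely [w (c - h ^ 2 / 4)]. With [F], this
     says that both leading parts are the integrand at [q] over [w] times the derivative of the
     phase, up to the same factor [i]; they enter with opposite signs. *)
  have E : e * expi (- (w * (h / 2) ^+ 2)) = e1 * expi (w * v q).
    by rewrite -!expiD vq; congr expi; field.
  have F : (q - p1) `^ (mu - 1) * (2 * w * (h / 2))^-1 = chirp q *
    (w^-1 * v q `^ (mu - 1)).
    by rewrite [RHS]mulrCA kv qp1; field; rewrite !lt0r_neq0.
  have G : e * (A q * ('i%C * expi (- (w * (h / 2) ^+ 2)) * (2 * w *
    (h / 2))^-1%:C)) =
      e1 * ((chirp q)%:C * ut q * ('i%C * expi (w * v q) * (w^-1 * v q `^
        (mu - 1))%:C)).
    transitivity ('i%C * ut q * (e * expi (- (w * (h / 2) ^+ 2))) *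
        ((q - p1) `^ (mu - 1) * (2 * w * (h / 2))^-1)%:C).
      by rewrite /A real_complexM; ring.
    by rewrite E F real_complexM; ring.
  rewrite /X /Y [_ * ut q * (_ - _)]mulrBr [e1 * (_ - _)]mulrBr -G.
  by ring.
rewrite (le_trans (modulusD _ _))// lerD//.
- rewrite modulusM modulus_expi mul1r modulusM ler_pM ?modulus_ge0//.
    rewrite modulusM modulus_real ger0_norm ?powR_ge0// qp1.
    by rewrite ler_wpM2l// powR_ge0.
  exact: fresnel_tail_asymp.
- rewrite modulusM modulus_expi mul1r modulusM modulusM modulus_real.
  have k0 : 0 <= chirp q.
    by rewrite mulr_ge0 ?powR_ge0// invr_ge0 mulr_ge0// qp1; move: h0; lra.
  rewrite ger0_norm// mulrAC [leRHS]mulrAC ler_pM ?modulus_ge0//.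
    by rewrite mulr_ge0// modulus_ge0.
  have H := ler_wpM2l k0 (osc_tail_asymp mu0 (ltW mu1) w0 v0).
  apply: le_trans H _; rewrite -kv -vq.
  rewrite (_ : mu - 2 = mu - 1 - 1); last by ring.
  rewrite [v q `^ (mu - 1 - 1)]powRB ?lt0r_neq0 ?implybT// powRr1 ?(ltW v0)//.
  by rewrite le_eqVlt; apply/orP; left; apply/eqP; ring.
Qed.

Hypothesis ut_p2 : ut p2 = 0.

(** The pieces telescope. The correction at [p2] vanishes with [ut p2], the two at [p0] give the
    doubled term, the one at [p1] has [v = 0], and those at [q] form the boundary terms. *)
Lemma stationary_phase_expansion :
  modulus (J p2 - (e * (A p0 * fresnel_tail w 0)) *+ 2
         - e1 * ((chirp p1)%:C * ut p1 * osc_tail mu w 0)) <=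
  ((1 - mu) * h `^ (mu - 2) * M + h `^ (mu - 1) * M) * (L * w `^ (- delta)) *
    ((p2 - p0) `^ (1 - gamma) / (1 - gamma)) +
  ((1 - mu) * (h / 2) `^ (mu - 2) * M + (h / 2) `^ (mu - 1) * M) *
    (L * w `^ (- delta)) * ((h / 2) `^ (1 - gamma) / (1 - gamma)) +
  (2 / h * M + M) * (w^-1 / h) * ((h / 2) `^ mu / mu) +
  ((h / 2) `^ (mu - 1) * M0 * (2^-1 * (w `^ (- (3 / 2)) * (h / 2) `^ (-2))) +
   (h / 2) `^ (mu - 1) / h * M0 * ((1 - mu) * (w `^ (-2) * (3 / 4 * h ^+ 2)^-1))).
Proof.
have Ap2 : A p2 = 0 by rewrite /A ut_p2 mulr0.
have Jp1 : J p1 = 0 by exact: primitive_left.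
have vp1 : v p1 = 0 by rewrite subrr mul0r.
have := lerD (lerD (lerD right_piece middle_piece) left_piece) boundary_terms.
rewrite Ap2 mul0r mulr0 addr0 Jp1 vp1 add0r.
set X := J p2 - _; set Y := J p0 - _ - _; set Z := J q + _ - _; set T := _ + e1 * _.
apply: le_trans; rewrite -(modulusN T).
have -> : J p2 - (e * (A p0 * fresnel_tail w 0)) *+ 2
         - e1 * ((chirp p1)%:C * ut p1 * osc_tail mu w 0) = X + Y + Z - T.
  by rewrite /X /Y /Z /T; ring.
rewrite (le_trans (modulusD _ _))// lerD2r (le_trans (modulusD _ _))// lerD2r.
exact: modulusD.
Qed.

End StationaryPhase.

(** * Comparison with the listed constants when [h = w ^ (- eps)] *)

Section Remainder.
Context {R : realType}.
Variables (p1 p2 mu delta K eps : R).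
Hypotheses (mu0 : 0 < mu) (mu1 : mu < 1) (eps0 : 0 < eps).
Hypothesis delta_bd : 1 / 2 < delta < 1.
Hypothesis p12 : p1 < p2.
Variable w : R.
Hypothesis hw : (p2 - p1) `^ (- 1 / eps) < w.

Local Notation h := (w `^ (- eps)).
Local Notation gamma := (gamma_exponent delta).
Local Notation L := (L_constant delta K).

Let w0 : 0 < w. Proof. by apply: le_lt_trans hw; exact: powR_ge0. Qed.

Let h0 : 0 < h. Proof. by rewrite powR_gt0. Qed.

(** This is the threshold on [w], raised to the power [eps]: it places the stationary point inside
    the interval. *)
Lemma width_lt : p1 + h < p2.
Proof.
rewrite -ltrBrDl powRN.
have d0 : 0 < p2 - p1 by rewrite subr_gt0.
rewrite -[ltRHS]invrK ltf_pV2 ?posrE ?invr_gt0 ?powR_gt0//.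
have -> : (p2 - p1)^-1 = ((p2 - p1) `^ (- 1 / eps)) `^ eps.
  by rewrite -powRrM divfK ?lt0r_neq0// powR_inv1// ltW.
by rewrite gt0_ltr_powR// ?nnegrE ?powR_ge0// ltW.
Qed.

Let width_powR a : w `^ (eps * a) = h `^ (- a).
Proof. by rewrite -powRrM mulrNN. Qed.

Lemma powR_width a b : w `^ (- b + eps * a) = w `^ (- b) * h `^ (- a).
Proof. by rewrite powRD ?lt0r_neq0 ?implybT// width_powR. Qed.

Let half_powR a : (h / 2) `^ a = h `^ a * 2 `^ (- a).
Proof. rewrite powRM ?(ltW h0)//; congr (_ * _).
by rewrite -(@powR_inv1 R 2)// -powRrM mulN1r. Qed.

Let powR2D (a b : R) : 2 `^ (a + b) = 2 `^ a * 2 `^ b.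
Proof. by rewrite powRD// lt0r_neq0 ?implybT. Qed.

Let powRhD (a b : R) : h `^ (a + b) = h `^ a * h `^ b.
Proof. by rewrite powRD// lt0r_neq0 ?implybT. Qed.

Let gamma1 : 0 < 1 - gamma.
Proof. by rewrite /gamma_exponent; case/andP: delta_bd => *; lra. Qed.

Let L_ge0 : 0 <= L.
Proof. by rewrite /L_constant mulr_ge0 ?powR_ge0// divr_ge0// sqrtr_ge0. Qed.

Variables (M0 M : R).
Hypotheses (M0_ge0 : 0 <= M0) (M_ge0 : 0 <= M).

(** Indices start at 0 here: [r k] is the constant numbered [k + 1] in the list. *)
Let r k : R := (common_constants p1 p2 mu delta K M0 M)`_k.

(** The only loss is the replacement of [p2 - p0] by [p2 - p1] under the power [1 - gamma]. *)
Lemma remainder_right :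
  ((1 - mu) * h `^ (mu - 2) * M + h `^ (mu - 1) * M) * (L * w `^ (- delta)) *
    ((p2 - (p1 + h)) `^ (1 - gamma) / (1 - gamma)) <=
  r 6 * w `^ (- delta + eps * (2 - mu)) + r 7 * w `^ (- delta + eps * (1 - mu)).
Proof.
rewrite !powR_width (opprB 2 mu) (opprB 1 mu) /r /=.
set X := (p2 - (p1 + h)) `^ _; set Y := (p2 - p1) `^ _.
have XY : X <= Y.
  rewrite /X /Y ge0_ler_powR ?(ltW gamma1)// ?nnegrE ?subr_ge0 ?(ltW p12) ?(ltW
    width_lt)//.
  by rewrite lerD2l lerN2 lerDl ltW.
set C := ((1 - mu) * h `^ (mu - 2) * M + h `^ (mu - 1) * M) * (L * w `^
  (- delta)) / (1 - gamma).
have C0 : 0 <= C.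
  rewrite divr_ge0 ?(ltW gamma1)// mulr_ge0//; last by rewrite mulr_ge0// powR_ge0.
  by rewrite addr_ge0// !mulr_ge0 ?powR_ge0// subr_ge0 ltW.
rewrite [leLHS](_ : _ = C * X); last by rewrite /C; ring.
rewrite [leRHS](_ : _ = C * Y); last by rewrite /C; ring.
exact: ler_wpM2l.
Qed.

(** The only loss is a factor [2 ^ (gamma - 1)], which is at most 1. *)
Lemma remainder_middle :
  ((1 - mu) * (h / 2) `^ (mu - 2) * M + (h / 2) `^ (mu - 1) * M) *
    (L * w `^ (- delta)) * ((h / 2) `^ (1 - gamma) / (1 - gamma)) <=
  r 3 * w `^ (- delta + eps * (1 + gamma - mu)) + r 4 * w `^ (- delta + eps *
    (gamma - mu)).
Proof.
rewrite !powR_width !half_powR (opprB (1 + gamma) mu) (opprB gamma mu)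
  (opprB 1 gamma) !(opprB mu) /r /=.
have -> : h `^ (mu - (1 + gamma)) = h `^ (mu - 2) * h `^ (1 - gamma).
  by rewrite -powRhD; congr (_ `^ _); ring.
have -> : h `^ (mu - gamma) = h `^ (mu - 1) * h `^ (1 - gamma).
  by rewrite -powRhD; congr (_ `^ _); ring.
set X := 2 `^ (gamma - 1).
have X1 : X <= 1.
  by rewrite /X -[leRHS](powRr0 2) ler_powR ?ler1n//; move: gamma1; lra.
set C := ((1 - mu) * (h `^ (mu - 2) * 2 `^ (2 - mu)) * M + h `^
  (mu - 1) * 2 `^ (1 - mu) * M) *
  (L * w `^ (- delta)) * h `^ (1 - gamma) / (1 - gamma).
have C0 : 0 <= C.
  rewrite divr_ge0 ?(ltW gamma1)// mulr_ge0 ?powR_ge0// mulr_ge0//; last first.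
    by rewrite mulr_ge0// powR_ge0.
  by rewrite addr_ge0// !mulr_ge0 ?powR_ge0// subr_ge0 ltW.
rewrite [leLHS](_ : _ = C * X); last by rewrite /C; ring.
rewrite [leRHS](_ : _ = C * 1); last by rewrite /C; ring.
exact: ler_wpM2l.
Qed.

(** After a common factor is taken out, the claim is [2 + h <= 4 (2 - mu) + 2 h]. *)
Lemma remainder_left :
  (2 / h * M + M) * (w^-1 / h) * ((h / 2) `^ mu / mu) <=
  r 0 * w `^ (- 1 + eps * (2 - mu)) + r 1 * w `^ (- 1 + eps * (1 - mu)).
Proof.
rewrite !powR_width !half_powR !opprB powR_inv1 ?(ltW w0)// /r /=.
have -> : h `^ mu = h `^ (mu - 2) * h ^+ 2.
  by rewrite -powR_mulrn ?(ltW h0)// -powRhD; congr (_ `^ _); ring.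
have -> : h `^ (mu - 1) = h `^ (mu - 2) * h.
  by rewrite -[X in _ * X](powRr1 (ltW h0)) -powRhD; congr (_ `^ _); ring.
have -> : 2 `^ (2 - mu) = 2 `^ (- mu) * 4 :> R.
  by rewrite addrC powR2D powR_mulrn//; ring.
have -> : 2 `^ (1 - mu) = 2 `^ (- mu) * 2 :> R.
  by rewrite addrC powR2D powRr1.
set X := 2 `^ (- mu); set C := M * w^-1 * X * h `^ (mu - 2) / mu.
have C0 : 0 <= C.
  by rewrite divr_ge0 ?(ltW mu0)// !mulr_ge0 ?powR_ge0// invr_ge0 ltW.
rewrite [leLHS](_ : _ = C * (2 + h)); last first.
  by rewrite /C; field; rewrite !lt0r_neq0.
rewrite [leRHS](_ : _ = C * (4 * (2 - mu) + 2 * h)); last by rewrite /C; ring.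
by apply: ler_wpM2l => //; move: h0 mu1; lra.
Qed.

(** The term with [w ^ (- 2)] is matched exactly: [2 ^ (3 - mu) / 3] comes from the value
    [3 h ^ 2 / 4] of [v] at [q]. The other one has room for the factor [sqrt pi >= 1]. *)
Lemma remainder_boundary :
  (h / 2) `^ (mu - 1) * M0 * (2^-1 * (w `^ (- (3 / 2)) * (h / 2) `^ (-2))) +
   (h / 2) `^ (mu - 1) / h * M0 * ((1 - mu) * (w `^ (-2) * (3 / 4 * h ^+ 2)^-1)) <=
  r 2 * w `^ (- 2 + eps * (4 - mu)) + r 5 * w `^ (- (3 / 2) + eps * (3 - mu)).
Proof.
rewrite !powR_width !half_powR !opprB opprK /r /= addrC lerD//.
- have -> : h `^ (mu - 4) = h `^ (mu - 1) * h ^- 3.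
    by rewrite -powR_invn ?(ltW h0)// -powRhD; congr (_ `^ _); ring.
  have -> : 2 `^ (3 - mu) = 2 `^ (1 - mu) * 4 :> R.
    have -> : 4 = 2 `^ 2 :> R by rewrite (@powR_mulrn R _ 2)//; ring.
    by rewrite -powR2D; congr (_ `^ _); ring.
  rewrite le_eqVlt; apply/orP; left; apply/eqP.
  by field; rewrite !lt0r_neq0.
- have -> : h `^ (mu - 3) = h `^ (mu - 1) * h `^ (-2).
    by rewrite -powRhD; congr (_ `^ _); ring.
  have -> : (2 `^ (mu - 2))^-1 = 2 `^ (1 - mu) * 2 `^ 2 / 2 :> R.
    rewrite -powRN -powR2D -[X in _ / X](powRr1 (_ : 0 <= 2))// -powRN -powR2D.
    by congr (_ `^ _); ring.
  set C := 2 `^ (1 - mu) * 2 `^ 2 / 2 * M0 * (w `^ (- (3 / 2)) * (h `^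
    (mu - 1) * h `^ (-2))).
  have C0 : 0 <= C by rewrite !mulr_ge0 ?powR_ge0// invr_ge0.
  rewrite [leLHS](_ : _ = C * 1); last by rewrite /C; ring.
  rewrite [leRHS](_ : _ = C * Num.sqrt pi); last by rewrite /C; ring.
  apply: ler_wpM2l => //.
  by rewrite -[leLHS]sqrtr1 ler_wsqrtr// (le_trans _ (@pi_ge2 R))// ler1n.
Qed.

Lemma remainder_bound_common (ut : R -> R[i]) :
  M0 = Linfty_norm p1 p2 ut -> M = W1infty_norm p1 p2 ut ->
  remainder_bound p1 p2 mu delta K eps ut 2 8 w =
  r 6 * w `^ (- delta + eps * (2 - mu)) + r 7 * w `^ (- delta + eps * (1 - mu)) +
  (r 3 * w `^ (- delta + eps * (1 + gamma - mu)) +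
   r 4 * w `^ (- delta + eps * (gamma - mu))) +
  (r 0 * w `^ (- 1 + eps * (2 - mu)) + r 1 * w `^ (- 1 + eps * (1 - mu))) +
  (r 2 * w `^ (- 2 + eps * (4 - mu)) + r 5 * w `^ (- (3 / 2) + eps * (3 - mu))).
Proof.
move=> M0E ME; rewrite /remainder_bound /index_iota !big_cons big_nil addr0.
rewrite /remainder_constant /remainder_exponent /remainder_alpha
  /remainder_beta -M0E -ME.
rewrite [k in k = _]/=.
set a1 := r 0 * _; set a2 := r 1 * _; set a3 := r 2 * _; set a4 := r 3 * _.
set a5 := r 4 * _; set a6 := r 5 * _; set a7 := r 6 * _; set a8 := r 7 * _.
by ring.
Qed.

End Remainder.

(** * Comparison of the exponents *)

Section Exponents.
Context {R : realType}.
Variables (mu delta eps : R).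

Lemma max_remainder_exponent_lt i n (x : R) : (0 < n)%N ->
  (forall k, (1 <= k <= n)%N -> remainder_exponent mu delta eps i k < x) ->
  max_remainder_exponent mu delta eps i n < x.
Proof.
move=> n0 H; rewrite /max_remainder_exponent.
rewrite big_seq; elim/big_ind: _ => //.
- by apply: H; rewrite n0.
- by move=> a b ax bx; rewrite gt_max ax.
- by move=> k; rewrite mem_index_iota ltnS; exact: H.
Qed.

Hypotheses (mu0 : 0 < mu) (eps0 : 0 < eps) (eps1 : eps < 1 / 2).
Hypotheses (delta_bd : 1 / 2 < delta < 1) (delta_eps : 1 / 2 + eps < delta).

(** The term [eps * mu] is common to both sides. Number 7 amounts to [delta > 1 / 2 + eps]. Numbers
    4 and 5 involve [eps * delta] through [gamma], and the positive product [d] makes them linear;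
    number 4 is exactly [d > 0]. *)
Lemma remainder_exponent_lt k : (1 <= k <= 8)%N ->
  remainder_exponent mu delta eps 2 k < - 1 / 2 + eps * (1 - mu).
Proof.
have d : 0 < (1 - 2 * eps) * (2 * delta - 1).
  by case/andP: delta_bd => *; apply: mulr_gt0; move: eps1; lra.
move: mu0 eps0 eps1 delta_eps d.
rewrite /remainder_exponent /remainder_alpha /remainder_beta.
rewrite /common_alphas /common_betas /gamma_exponent.
case: k => [//|k] mu_gt0 eps_gt0 eps_lt de d /andP[_].
do 8 (case: k => [_|k] /=; first by lra).
by [].
Qed.

End Exponents.

(** * Identification of [H] and [K_mu] *)

Section LeadingTerms.
Context {R : realType}.
Variables (p1 mu eps w c : R) (ut : R -> R[i]).
Hypothesis w0 : 0 < w.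

Local Notation h := (w `^ (- eps)).

(** The amplitude at [p0] contributes [h ^ (mu - 1) = w ^ (eps (1 - mu))], and twice the tail at 0
    is [sqrt (pi / w)] times a phase. *)
Lemma stationary_leading_term :
  (expi (w * c) * (amplitude p1 mu ut (p1 + h) * fresnel_tail w 0)) *+ 2 =
  leading_H p1 eps w c ut * (w `^ (- 1 / 2 + eps * (1 - mu)))%:C.
Proof.
rewrite fresnel_tail0// /amplitude /leading_H /stationary_point.
have -> : w `^ (- 1 / 2 + eps * (1 - mu)) = w `^ (- (1 / 2)) *
  (p1 + h - p1) `^ (mu - 1).
  rewrite [p1 + h - p1]addrAC subrr add0r -powRrM -powRD ?lt0r_neq0 ?implybT//.
  by congr (_ `^ _); ring.
rewrite -mulr_natl -[2%:R](_ : 2%:C = _) ?rmorph_nat//.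
have -> : (2^-1 * (w `^ (- (1 / 2)) * Num.sqrt pi))%:C =
    (2^-1)%:C * ((w `^ (- (1 / 2)))%:C * (Num.sqrt pi)%:C) :> R[i].
  by rewrite !real_complexM.
rewrite real_complexM.
have E : 2%:C * (2^-1)%:C = 1 :> R[i] by rewrite -real_complexM divff.
set a := (2^-1)%:C in E *; set b := 2%:C in E *.
set s := (Num.sqrt pi)%:C; set t := (w `^ _)%:C; set y := (_ `^ _)%:C.
transitivity (b * a * (s * expi (- (pi / 4)) * expi (w * c) * ut (p1 + h) *
  (t * y))).
  by ring.
by rewrite E mul1r.
Qed.

(** At [p1] the factor [chirp] equals [(2 h) ^ (- mu)], the origin of both [2 ^ mu] in the
    denominator of [K_mu] and [eps * mu] in the exponent. *)
Lemma endpoint_leading_term : 0 < mu -> mu <= 1 ->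
  expi (w * (- h ^+ 2 + c)) * ((chirp p1 mu h p1)%:C * ut p1 * osc_tail mu w 0) =
  leading_K p1 eps w c mu ut * (w `^ (- mu + eps * mu))%:C.
Proof.
move=> mu0 mu1; have h0 : 0 < h by rewrite powR_gt0.
rewrite osc_tail0// /leading_K /phase /stationary_point.
have -> : - (p1 - (p1 + h)) ^+ 2 + c = - h ^+ 2 + c by ring.
have -> : chirp p1 mu h p1 = (2 `^ mu)^-1 * w `^ (eps * mu).
  have h2 : 0 < 2 * h by rewrite mulr_gt0.
  rewrite /chirp !subrr !subr0 -(powR_inv1 (ltW h2)) -powRD ?lt0r_neq0 ?implybT//.
  rewrite (_ : 1 - mu - 1 = - mu); last by ring.
  by rewrite powRM ?(ltW h0)// -powRN -powRrM mulrNN.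
have -> : w `^ (- mu + eps * mu) = w `^ (- mu) * w `^ (eps * mu).
  by rewrite powRD ?lt0r_neq0 ?implybT.
by rewrite !real_complexM; ring.
Qed.

End LeadingTerms.

(** * The expansion with both leading terms, and bounds on each of them *)

Section Combination.
Context {R : realType}.
Variables (p1 p2 mu eps delta K : R) (ut U : R -> R[i]).
Hypotheses (hp : p1 < p2) (hmu : 0 < mu < 1).
Hypothesis hU : forall p, p1 < p <= p2 -> U p = ((p - p1) `^ (mu - 1))%:C * ut p.
Hypotheses (hut : C1_on_complex `[p1, p2] ut) (hU2 : U p2 = 0).
Hypotheses (heps : 0 < eps < 1 / 2) (hdelta : 1 / 2 < delta < 1).
Hypothesis hK0 : 0 < K.
Hypothesis hK : Num.sqrt pi / 2 * K ^+ 2 - 1 / 2 * K - Num.sqrt pi / 4 = 0.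

Lemma modulus_le_Linfty_norm_C1 x : p1 < x < p2 ->
  modulus (ut x) <= Linfty_norm p1 p2 ut.
Proof.
have cut := C1_on_complex_ccontinuous hut.
have [C HC] := ccontinuous_bounded (ltW hp) cut.
apply: (modulus_le_Linfty_norm hp (C := C)).
  by apply: ccontinuous_on_subset cut; exact: subset_itv_oo_cc.
by move=> y /andP[/ltW py /ltW yp]; apply: HC; rewrite py.
Qed.

Lemma modulus_derive_le_Linfty_norm_C1 (du : R -> R[i]) x :
  ccontinuous_on `[p1, p2] du ->
  (forall x, p1 < x < p2 -> is_cderive ut x (du x)) -> p1 < x < p2 ->
  modulus (du x) <= Linfty_norm p1 p2 (derive1_complex ut).
Proof.
move=> cdu dP.
have dE y : p1 < y < p2 -> derive1_complex ut y = du y.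
  move=> /dP[d1 d2]; apply: complexP => /=; rewrite derive1E;
    [exact: (@derive_val _ _ _ _ _ _ _ d1)|exact: (@derive_val _ _ _ _ _ _ _ d2)].
have [C HC] := ccontinuous_bounded (ltW hp) cdu.
move=> xp; rewrite -dE//; apply: (modulus_le_Linfty_norm hp (C := C)) => //.
  have [c1 c2] : ccontinuous_on `]p1, p2[ du.
    by apply: ccontinuous_on_subset cdu; exact: subset_itv_oo_cc.
  by split; [apply: within_continuous_eq c1|apply: within_continuous_eq c2];
    move=> y yI; (have yp : p1 < y < p2 by move: yI; rewrite inE/= in_itv);
    by rewrite dE.
move=> y /[dup] /andP[/ltW py /ltW yp] /dE ->.
by apply: HC; rewrite py.
Qed.

(** If [sqrt pi * K < 1], then [sqrt pi * K ^ 2 < K], and the left side of the equation defining [K]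
    is negative. *)
Let sqrtpiK : 1 <= Num.sqrt pi * K.
Proof.
have s0 : 0 < Num.sqrt pi :> R by rewrite sqrtr_gt0 pi_gt0.
rewrite leNgt; apply/negP => sK.
have H : (Num.sqrt pi * K) * K < K by rewrite gtr_pMl.
move: hK; rewrite expr2; move: H s0; nra.
Qed.

Local Notation M0 := (Linfty_norm p1 p2 ut).

Let M0_ge0 : 0 <= M0.
Proof.
apply: le_trans (modulus_ge0 _) (modulus_le_Linfty_norm_C1 (x := (p1 + p2) / 2) _).
by move: hp => ?; apply/andP; split; lra.
Qed.

(** Common source of the three cases: both leading terms are kept, and the remainder is the list of
    eight, that is case [i = 2], for every [mu] in []0, 1[]. *)
Lemma oscillatory_integral_expansion omega c : (p2 - p1) `^ (- 1 / eps) < omega ->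
  modulus (Cintegral `]p1, p2] (fun p => U p * expi
    (omega * phase p1 eps omega c p))
    - leading_H p1 eps omega c ut * (omega `^ (- 1 / 2 + eps * (1 - mu)))%:C
    - leading_K p1 eps omega c mu ut * (omega `^ (- mu + eps * mu))%:C)
  <= remainder_bound p1 p2 mu delta K eps ut 2 8 omega.
Proof.
move=> hw; have /andP[mu0 mu1] := hmu; have /andP[eps0 eps1] := heps.
have w0 : 0 < omega by apply: le_lt_trans hw; exact: powR_ge0.
have h0 : 0 < omega `^ (- eps) by rewrite powR_gt0.
have ph := width_lt eps0 hp hw.
have cut := C1_on_complex_ccontinuous hut.
have [du cdu dP] := C1_on_complex_is_cderive hut.
have du_le := modulus_derive_le_Linfty_norm_C1 cdu dP.
have M1_ge0 : 0 <= Linfty_norm p1 p2 (derive1_complex ut).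
  apply: le_trans (modulus_ge0 _) (du_le ((p1 + p2) / 2) _).
  by move: hp => ?; apply/andP; split; lra.
have M0M : M0 <= W1infty_norm p1 p2 ut by rewrite /W1infty_norm lerDl.
have du_leM x : p1 < x < p2 -> modulus (du x) <= W1infty_norm p1 p2 ut.
  by move=> /du_le /le_trans; apply; rewrite /W1infty_norm lerDr.
have ut_p2 : ut p2 = 0.
  have := hU2; rewrite hU ?hp ?lexx// => /eqP; rewrite mulf_eq0 => /orP[|/eqP//].
  by rewrite -[0]/(0%:C) (inj_eq (@complexI R)) gt_eqF// powR_gt0// subr_gt0.
have := stationary_phase_expansion c mu0 mu1 h0 ph w0 hdelta sqrtpiK cut dP
  modulus_le_Linfty_norm_C1 du_leM M0M ut_p2.
rewrite stationary_leading_term// endpoint_leading_term// ?(ltW mu1)//.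
set X := modulus _; set Y := modulus _; have -> : X = Y.
  congr (modulus (_ - _ - _)); apply: eq_Cintegral => p.
  by rewrite /= in_itv/= => /hU ->.
move/le_trans; apply.
have M_ge0 := le_trans M0_ge0 M0M.
rewrite (remainder_bound_common _ _ _ _ _ (erefl M0) (erefl
  (W1infty_norm p1 p2 ut))).
apply: lerD; last exact: remainder_boundary.
apply: lerD; last exact: remainder_left.
apply: lerD; first exact: remainder_right.
exact: remainder_middle.
Qed.

(** For [mu < 1 / 2], this turns [H] into the first remainder term. *)
Lemma leading_H_le omega c : p1 < stationary_point p1 eps omega < p2 ->
  modulus (leading_H p1 eps omega c ut) <= Num.sqrt pi * M0.
Proof.
move=> sp; rewrite !modulusM !modulus_expi !mulr1 modulus_real ger0_norm
  ?sqrtr_ge0//.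
by rewrite ler_wpM2l ?sqrtr_ge0// modulus_le_Linfty_norm_C1.
Qed.

(** For [mu > 1 / 2], this turns [K_mu] into the first remainder term. *)
Lemma leading_K_le omega c :
  modulus (leading_K p1 eps omega c mu ut) <= Gamma mu / 2 `^ mu * M0.
Proof.
have G0 : 0 <= Gamma mu / 2 `^ mu.
  rewrite divr_ge0 ?powR_ge0//; apply: Rintegral_ge0 => t _.
  by rewrite mulr_ge0 ?powR_ge0 ?expR_ge0.
rewrite !modulusM !modulus_expi !mulr1 modulus_real ger0_norm//.
rewrite ler_wpM2l//; apply: (modulus_le_left_end hp
  (C1_on_complex_ccontinuous hut)).
exact: modulus_le_Linfty_norm_C1.
Qed.

End Combination.

Theorem theorem3p4 (R : realType) (p1 p2 mu eps delta K : R)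
    (ut U : R -> R[i])
    (hp : p1 < p2) (hmu : 0 < mu < 1)
    (hU : forall p, p1 < p <= p2 -> U p = ((p - p1) `^ (mu - 1))%:C * ut p)
    (hut : C1_on_complex `[p1, p2] ut)
    (hut1 : ut p1 != 0) (hU2 : U p2 = 0)
    (heps : 0 < eps < 1 / 2)
    (hdelta : 1 / 2 < delta < 1)
    (hdelta_eps : 1 / 2 + eps < delta) (hdelta_mu : mu < delta)
    (hK0 : 0 < K)
    (hK : Num.sqrt pi / 2 * K ^+ 2 - 1 / 2 * K - Num.sqrt pi / 4 = 0) :
  let I omega c := Cintegral `]p1, p2]
    (fun p => U p * expi (omega * phase p1 eps omega c p)) in
  let H omega c := leading_H p1 eps omega c ut in
  let Kmu omega c := leading_K p1 eps omega c mu ut in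
  let bound i n omega := remainder_bound p1 p2 mu delta K eps ut i n omega in
  let max_exponent i n := max_remainder_exponent mu delta eps i n in
  [/\ 1 / 2 < mu ->
        (forall omega c : R, (p2 - p1) `^ (- 1 / eps) < omega ->
           modulus (I omega c -
             H omega c * (omega `^ (- 1 / 2 + eps * (1 - mu)))%:C)
             <= bound 1%N 9%N omega) /\
        max_exponent 1%N 9%N < - 1 / 2 + eps * (1 - mu),
      mu = 1 / 2 ->
        (forall omega c : R, (p2 - p1) `^ (- 1 / eps) < omega ->
           modulus (I omega c -
             (H omega c + Kmu omega c) *
               (omega `^ (- 1 / 2 + 1 / 2 * eps))%:C)
             <= bound 2%N 8%N omega) /\
        max_exponent 2%N 8%N < - 1 / 2 + 1 / 2 * eps
    & mu < 1 / 2 ->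
        (forall omega c : R, (p2 - p1) `^ (- 1 / eps) < omega ->
           modulus (I omega c -
             Kmu omega c * (omega `^ (- mu + eps * mu))%:C)
             <= bound 3%N 9%N omega) /\
        max_exponent 3%N 9%N < - mu + eps * mu].
Proof.
move=> I H Kmu bound max_exponent.
have /andP[mu0 mu1] := hmu; have /andP[eps0 eps1] := heps.
have key := oscillatory_integral_expansion hp hmu hU hut hU2 heps hdelta hK0 hK.
have w_gt0 omega : (p2 - p1) `^ (- 1 / eps) < omega -> 0 < omega.
  by apply: le_lt_trans; exact: powR_ge0.
have expo k : (1 <= k <= 8)%N ->
    remainder_exponent mu delta eps 2 k < - 1 / 2 + eps * (1 - mu).
  exact: remainder_exponent_lt.
split=> [mu_gt|muE|mu_lt]; split.
- move=> omega c hw; have w0 := w_gt0 _ hw.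
  set B := bound _ _ _.
  have -> : B = Gamma mu / 2 `^ mu * Linfty_norm p1 p2 ut *
      omega `^ (- mu + eps * mu) + bound 2 8 omega.
    by rewrite /B /bound /remainder_bound /index_iota !big_cons !big_nil.
  have E : I omega c - H omega c * (omega `^ (- 1 / 2 + eps * (1 - mu)))%:C =
      Kmu omega c * (omega `^ (- mu + eps * mu))%:C +
      (I omega c - H omega c * (omega `^ (- 1 / 2 + eps * (1 - mu)))%:C -
       Kmu omega c * (omega `^ (- mu + eps * mu))%:C) by ring.
  rewrite E (le_trans (modulusD _ _))// lerD//; last exact: key.
  rewrite modulusM modulus_real ger0_norm ?powR_ge0//.
  by rewrite ler_wpM2r ?powR_ge0// leading_K_le.
- apply: max_remainder_exponent_lt => // -[//|[_|k]].
    rewrite /remainder_exponent /remainder_alpha /remainder_beta /=.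
    (* Half of this product is the gap between the exponents of [H] and [K_mu]. The remaining
       exponents are those of case 2 with the index shifted by one. *)
    have : 0 < (1 - 2 * eps) * (2 * mu - 1) by apply: mulr_gt0; lra.
    by lra.
  exact: (expo k.+1).
- move=> omega c hw.
  (* At [mu = 1 / 2] the two leading exponents coincide, so the two terms merge. *)
  have := key omega c hw; rewrite (_ : - 1 / 2 + eps *
    (1 - mu) = - 1 / 2 + 1 / 2 * eps); last first.
    by rewrite muE; field.
  rewrite (_ : - mu + eps * mu = - 1 / 2 + 1 / 2 * eps); last by rewrite muE; field.
  by rewrite -addrA -opprD -mulrDl.
- apply: max_remainder_exponent_lt => // k k8.
  by rewrite (lt_le_trans (expo k k8))// muE; lra.
- move=> omega c hw; have w0 := w_gt0 _ hw.
  set B := bound _ _ _.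
  have -> : B = Num.sqrt pi * Linfty_norm p1 p2 ut *
      omega `^ (- 2^-1 + eps * (1 - mu)) + bound 2 8 omega.
    by rewrite /B /bound /remainder_bound /index_iota !big_cons !big_nil.
  have -> : - 2^-1 + eps * (1 - mu) = - 1 / 2 + eps * (1 - mu) by field.
  have E : I omega c - Kmu omega c * (omega `^ (- mu + eps * mu))%:C =
      H omega c * (omega `^ (- 1 / 2 + eps * (1 - mu)))%:C +
      (I omega c - H omega c * (omega `^ (- 1 / 2 + eps * (1 - mu)))%:C -
       Kmu omega c * (omega `^ (- mu + eps * mu))%:C) by ring.
  rewrite E (le_trans (modulusD _ _))// lerD//; last exact: key.
  rewrite modulusM modulus_real ger0_norm ?powR_ge0//.
  rewrite ler_wpM2r ?powR_ge0// leading_H_le//.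
  by rewrite /stationary_point ltrDl powR_gt0//= (width_lt eps0 hp hw).
- have X : - 1 / 2 + eps * (1 - mu) < - mu + eps * mu.
    (* The same gap with the opposite sign: now [K_mu] dominates, and the bounds by the exponent of
       [H] are weakened through [X]. *)
    have : 0 < (1 - 2 * eps) * (1 - 2 * mu) by apply: mulr_gt0; lra.
    by lra.
  apply: max_remainder_exponent_lt => // -[//|[_|k]].
    by rewrite /remainder_exponent /remainder_alpha /remainder_beta /=;
      move: X; lra.
  by move=> k8; apply: lt_trans X; exact: (expo k.+1).
Qed.
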